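(* Let $\mathcal{C}$ be a symmetric monoidal category. There is an equivalence between the category $\mathsf{SplitExt}(\mathsf{AssBiAlg}_{\mathcal{C}})$ of split extensions of associative bialgebras in $\mathcal{C}$ and the category $\mathsf{Act}(\mathsf{AssBiAlg}_{\mathcal{C}})$ of actions of associative bialgebras in $\mathcal{C}$.
   Context: $(\mathcal{C},\otimes,I,\sigma)$ is a symmetric monoidal category (associativity and unit isomorphisms are suppressed); $f\cdot g$ denotes composition ($g$ first) and $1_X$ the identity of $X$. An associative bialgebra is $(B,m,u_B,\Delta,\epsilon_B)$ with $(B,m,u_B)$ an associative unital algebra, $(B,\Delta,\epsilon_B)$ a coassociative counital coalgebra, and $\Delta\cdot m=(m\otimes m)\cdot(1_B\otimes\sigma_{B,B}\otimes 1_B)\cdot(\Delta\otimes\Delta)$, $\Delta\cdot u_B=u_B\otimes u_B$, $\epsilon_B\cdot m=\epsilon_B\otimes\epsilon_B$, $\epsilon_B\cdot u_B=1_I$. A bialgebra morphism preserves $m,u,\Delta,\epsilon$; a coalgebra morphism preserves $\Delta,\epsilon$. Objects of $\mathsf{Act}(\mathsf{AssBiAlg}_{\mathcal{C}})$: morphisms $\triangleright\colon B\otimes X\to X$ in $\mathcal{C}$, with $B,X$ associative bialgebras, such that $\triangleright\cdot(u_B\otimes 1_X)=1_X$; $\triangleright\cdot(1_B\otimes u_X)=u_X\cdot\epsilon_B$; $(1_B\otimes\triangleright)\cdot(\Delta\otimes 1_X)=(1_B\otimes\triangleright)\cdot(\sigma_{B,B}\otimes 1_X)\cdot(\Delta\otimes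 1_X)$; $\epsilon_X\cdot\triangleright=\epsilon_B\otimes\epsilon_X$; $\Delta\cdot\triangleright=(\triangleright\otimes\triangleright)\cdot(1_B\otimes\sigma_{B,X}\otimes 1_X)\cdot(\Delta\otimes\Delta)$; $\triangleright\cdot(m\otimes 1_X)=\triangleright\cdot(1_B\otimes\triangleright)$; $\triangleright\cdot(1_B\otimes m)=m\cdot(\triangleright\otimes\triangleright)\cdot(1_B\otimes\sigma_{B,X}\otimes 1_X)\cdot(\Delta\otimes 1_X\otimes 1_X)$. Morphisms from $\triangleright$ to $\triangleright'\colon B'\otimes X'\to X'$: pairs of bialgebra morphisms $g\colon B\to B'$, $v\colon X\to X'$ with $v\cdot\triangleright=\triangleright'\cdot(g\otimes v)$. Objects of $\mathsf{SplitExt}(\mathsf{AssBiAlg}_{\mathcal{C}})$: associative bialgebras $X,A,B$, bialgebra morphisms $\kappa\colon X\to A$, $\alpha\colon A\to B$, $e\colon B\to A$ and a morphism $\lambda\colon A\to X$ in $\mathcal{C}$ such that (1) $\lambda\cdot\kappa=1_X$, $\alpha\cdot e=1_B$; (2) $\lambda\cdot e=u_X\cdot\epsilon_B$, $\alpha\cdot\kappa=u_B\cdot\epsilon_X$; (3) $m\cdot((\kappa\cdot\lambda)\otimes(e\cdot\alpha))\cdot\Delta=1_A$; (4) $\lambda\cdot m\cdot(\kappa\otimes e)=1_X\otimes\epsilon_B$; (5) $(1_B\otimes\lambda)\cdot(1_B\otimes m)\cdot(1_B\otimes e\otimes\kappa)\cdot(\Delta\otimes 1_X)=(1_B\otimes\lambda)\cdot(1_B\otimes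 m)\cdot(1_B\otimes e\otimes\kappa)\cdot(\sigma_{B,B}\otimes 1_X)\cdot(\Delta\otimes 1_X)$; (6) $\lambda$ is a morphism of coalgebras preserving the unit. Morphisms from $(X,A,B,\kappa,\alpha,e,\lambda)$ to $(X',A',B',\kappa',\alpha',e',\lambda')$: triples $(g,v,p)$ of bialgebra morphisms $g\colon B\to B'$, $v\colon X\to X'$, $p\colon A\to A'$ with $p\cdot\kappa=\kappa'\cdot v$, $p\cdot e=e'\cdot g$, $\alpha'\cdot p=g\cdot\alpha$, $\lambda'\cdot p=v\cdot\lambda$. *)

(* Defs.v *)
From Stdlib Require Import ProofIrrelevance.

Set Implicit Arguments.
Unset Strict Implicit.
Unset Printing Implicit Defensive.

Declare Scope cat_scope.
Delimit Scope cat_scope with cat.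
Local Open Scope cat_scope.

(** * Categories and equivalences *)

Record Category := {
  Ob :> Type;
  Hom : Ob -> Ob -> Type;
  idm : forall X, Hom X X;
  comp : forall X Y Z, Hom Y Z -> Hom X Y -> Hom X Z;
  comp_idl : forall X Y (f : Hom X Y), comp (idm Y) f = f;
  comp_idr : forall X Y (f : Hom X Y), comp f (idm X) = f;
  comp_assoc : forall W X Y Z (h : Hom Y Z) (g : Hom X Y) (f : Hom W X),
    comp (comp h g) f = comp h (comp g f)
}.

Arguments Hom {c} X Y.
Arguments idm {c} X.

(* [f ∘ g] is "[g] first, then [f]". *)
Notation "f ∘ g" := (comp f g) (at level 40, left associativity) : cat_scope.
Notation "'1_' X" := (idm X) (at level 5, X at level 5, format "1_ X") : cat_scope.

Record Iso (C : Category) (X Y : C) := {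
  iso_mor :> Hom X Y;
  iso_inv : Hom Y X;
  iso_invl : iso_inv ∘ iso_mor = 1_X;
  iso_invr : iso_mor ∘ iso_inv = 1_Y
}.

Record Functor (C D : Category) := {
  fob :> C -> D;
  fmap : forall X Y : C, Hom X Y -> Hom (fob X) (fob Y);
  fmap_id : forall X : C, fmap (1_X) = 1_(fob X);
  fmap_comp : forall (X Y Z : C) (g : Hom Y Z) (f : Hom X Y),
    fmap (g ∘ f) = fmap g ∘ fmap f
}.

Definition functor_id (C : Category) : Functor C C.
Proof. now refine {| fob := fun X => X; fmap := fun _ _ f => f |}. Defined.

Definition functor_comp (C D E : Category) (G : Functor D E) (F : Functor C D) :
  Functor C E.
Proof.
  refine {| fob := fun X => G (F X); fmap := fun _ _ f => fmap G (fmap F f) |}.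
  - intros X. now rewrite !fmap_id.
  - intros X Y Z g f. now rewrite !fmap_comp.
Defined.

Record NatIso (C D : Category) (F G : Functor C D) := {
  nat_iso :> forall X : C, Iso (F X) (G X);
  nat_iso_natural : forall (X Y : C) (f : Hom X Y),
    nat_iso Y ∘ fmap F f = fmap G f ∘ nat_iso X
}.

Definition equivalent_categories (C D : Category) : Prop :=
  exists (F : Functor C D) (G : Functor D C),
    inhabited (NatIso (functor_comp G F) (functor_id C)) /\
    inhabited (NatIso (functor_comp F G) (functor_id D)).

(** * Symmetric monoidal categories *)

Record MonoidalCategory := {
  mon_cat :> Category;
  tens : mon_cat -> mon_cat -> mon_cat;
  tensm : forall X X' Y Y' : mon_cat,
    Hom X X' -> Hom Y Y' -> Hom (tens X Y) (tens X' Y');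
  munit : mon_cat;
  assoc : forall X Y Z : mon_cat, Iso (tens (tens X Y) Z) (tens X (tens Y Z));
  lunit : forall X : mon_cat, Iso (tens munit X) X;
  runit : forall X : mon_cat, Iso (tens X munit) X;
  tensm_id : forall X Y : mon_cat, tensm (1_X) (1_Y) = 1_(tens X Y);
  tensm_comp : forall (X X' X'' Y Y' Y'' : mon_cat)
      (f' : Hom X' X'') (f : Hom X X') (g' : Hom Y' Y'') (g : Hom Y Y'),
    tensm (f' ∘ f) (g' ∘ g) = tensm f' g' ∘ tensm f g;
  assoc_natural : forall (X X' Y Y' Z Z' : mon_cat)
      (f : Hom X X') (g : Hom Y Y') (h : Hom Z Z'),
    assoc X' Y' Z' ∘ tensm (tensm f g) h = tensm f (tensm g h) ∘ assoc X Y Z;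
  lunit_natural : forall (X X' : mon_cat) (f : Hom X X'),
    lunit X' ∘ tensm (1_munit) f = f ∘ lunit X;
  runit_natural : forall (X X' : mon_cat) (f : Hom X X'),
    runit X' ∘ tensm f (1_munit) = f ∘ runit X;
  triangle : forall X Y : mon_cat,
    tensm (1_X) (lunit Y) ∘ assoc X munit Y = tensm (runit X) (1_Y);
  pentagon : forall W X Y Z : mon_cat,
    tensm (1_W) (assoc X Y Z) ∘ assoc W (tens X Y) Z ∘ tensm (assoc W X Y) (1_Z)
    = assoc W X (tens Y Z) ∘ assoc (tens W X) Y Z
}.

Arguments munit {m}.
Arguments assoc {m} X Y Z.
Arguments lunit {m} X.
Arguments runit {m} X.

Notation "X ⊗ Y" := (tens X Y) (at level 30, right associativity) : cat_scope.
Notation "f ⊗₁ g" := (tensm f g) (at level 30, right associativity) : cat_scope.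

Record SymmetricMonoidalCategory := {
  sym_mon :> MonoidalCategory;
  braid : forall X Y : sym_mon, Hom (X ⊗ Y) (Y ⊗ X);
  braid_natural : forall (X X' Y Y' : sym_mon) (f : Hom X X') (g : Hom Y Y'),
    braid X' Y' ∘ (f ⊗₁ g) = (g ⊗₁ f) ∘ braid X Y;
  braid_sym : forall X Y : sym_mon, braid Y X ∘ braid X Y = 1_(X ⊗ Y);
  hexagon : forall X Y Z : sym_mon,
    assoc Y Z X ∘ braid X (Y ⊗ Z) ∘ assoc X Y Z
    = (1_Y ⊗₁ braid X Z) ∘ assoc Y X Z ∘ (braid X Y ⊗₁ 1_Z)
}.

Arguments braid {s} X Y.

(* [1_W ⊗ σ_{X,Y} ⊗ 1_Z] with the associativity isomorphisms made explicit. *)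
Definition mid_swap (C : SymmetricMonoidalCategory) (W X Y Z : C) :
  Hom ((W ⊗ X) ⊗ (Y ⊗ Z)) ((W ⊗ Y) ⊗ (X ⊗ Z)) :=
  iso_inv (assoc W Y (X ⊗ Z))
  ∘ (1_W ⊗₁ (assoc Y X Z ∘ (braid X Y ⊗₁ 1_Z) ∘ iso_inv (assoc X Y Z)))
  ∘ assoc W X (Y ⊗ Z).

(** * Associative bialgebras *)

(* [lunit munit] is used for [I ⊗ I ≅ I]; it coincides with [runit munit]. *)
Record Bialgebra (C : SymmetricMonoidalCategory) := {
  carrier :> C;
  mul : Hom (carrier ⊗ carrier) carrier;
  unit : Hom munit carrier;
  comul : Hom carrier (carrier ⊗ carrier);
  counit : Hom carrier munit;
  mul_assoc :
    mul ∘ (mul ⊗₁ 1_carrier)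
    = mul ∘ (1_carrier ⊗₁ mul) ∘ assoc carrier carrier carrier;
  mul_unitl : mul ∘ (unit ⊗₁ 1_carrier) = lunit carrier;
  mul_unitr : mul ∘ (1_carrier ⊗₁ unit) = runit carrier;
  comul_coassoc :
    assoc carrier carrier carrier ∘ (comul ⊗₁ 1_carrier) ∘ comul
    = (1_carrier ⊗₁ comul) ∘ comul;
  comul_counitl : lunit carrier ∘ (counit ⊗₁ 1_carrier) ∘ comul = 1_carrier;
  comul_counitr : runit carrier ∘ (1_carrier ⊗₁ counit) ∘ comul = 1_carrier;
  comul_mul :
    comul ∘ mul
    = (mul ⊗₁ mul) ∘ mid_swap carrier carrier carrier carrier ∘ (comul ⊗₁ comul);
  comul_unit : comul ∘ unit = (unit ⊗₁ unit) ∘ iso_inv (lunit munit);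
  counit_mul : counit ∘ mul = lunit munit ∘ (counit ⊗₁ counit);
  counit_unit : counit ∘ unit = 1_munit
}.

Arguments mul {C} b.
Arguments unit {C} b.
Arguments comul {C} b.
Arguments counit {C} b.

Section BialgebraMorphisms.
Variable C : SymmetricMonoidalCategory.

Definition preserves_mul (A B : Bialgebra C) (f : Hom A B) : Prop :=
  f ∘ mul A = mul B ∘ (f ⊗₁ f).
Definition preserves_unit (A B : Bialgebra C) (f : Hom A B) : Prop :=
  f ∘ unit A = unit B.
Definition preserves_comul (A B : Bialgebra C) (f : Hom A B) : Prop :=
  comul B ∘ f = (f ⊗₁ f) ∘ comul A.
Definition preserves_counit (A B : Bialgebra C) (f : Hom A B) : Prop :=
  counit B ∘ f = counit A.

Definition is_coalgebra_morphism (A B : Bialgebra C) (f : Hom A B) : Prop :=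
  preserves_comul f /\ preserves_counit f.

Record BialgHom (A B : Bialgebra C) := {
  bialg_mor :> Hom A B;
  bialg_mor_mul : preserves_mul bialg_mor;
  bialg_mor_unit : preserves_unit bialg_mor;
  bialg_mor_comul : preserves_comul bialg_mor;
  bialg_mor_counit : preserves_counit bialg_mor
}.

Lemma BialgHom_eq (A B : Bialgebra C) (f g : BialgHom A B) :
  bialg_mor f = bialg_mor g -> f = g.
Proof.
  destruct f, g; simpl; intros ->; f_equal; apply proof_irrelevance.
Qed.

Definition bialg_id (A : Bialgebra C) : BialgHom A A.
Proof.
  exists (1_A); unfold preserves_mul, preserves_unit, preserves_comul, preserves_counit;
    now rewrite ?tensm_id, ?comp_idl, ?comp_idr.
Defined.

Definition bialg_comp (A B D : Bialgebra C) (g : BialgHom B D) (f : BialgHom A B) :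
  BialgHom A D.
Proof.
  exists (g ∘ f); unfold preserves_mul, preserves_unit, preserves_comul, preserves_counit.
  - now rewrite tensm_comp, comp_assoc, bialg_mor_mul, <- comp_assoc, bialg_mor_mul,
      comp_assoc.
  - now rewrite comp_assoc, !bialg_mor_unit.
  - now rewrite tensm_comp, <- comp_assoc, bialg_mor_comul, comp_assoc, bialg_mor_comul,
      comp_assoc.
  - now rewrite <- comp_assoc, !bialg_mor_counit.
Defined.

End BialgebraMorphisms.

(** * Actions of associative bialgebras *)

Section Actions.
Variable C : SymmetricMonoidalCategory.

Record Action := {
  act_B : Bialgebra C;
  act_X : Bialgebra C;
  act : Hom (act_B ⊗ act_X) act_X;
  act_unitl : act ∘ (unit act_B ⊗₁ 1_act_X) = lunit act_X;
  act_unitr :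
    act ∘ (1_act_B ⊗₁ unit act_X) = unit act_X ∘ counit act_B ∘ runit act_B;
  act_cocomm :
    (1_act_B ⊗₁ act) ∘ assoc act_B act_B act_X ∘ (comul act_B ⊗₁ 1_act_X)
    = (1_act_B ⊗₁ act) ∘ assoc act_B act_B act_X
      ∘ (braid act_B act_B ⊗₁ 1_act_X) ∘ (comul act_B ⊗₁ 1_act_X);
  act_counit :
    counit act_X ∘ act = lunit munit ∘ (counit act_B ⊗₁ counit act_X);
  act_comul :
    comul act_X ∘ act
    = (act ⊗₁ act) ∘ mid_swap act_B act_B act_X act_X
      ∘ (comul act_B ⊗₁ comul act_X);
  act_mull :
    act ∘ (mul act_B ⊗₁ 1_act_X)
    = act ∘ (1_act_B ⊗₁ act) ∘ assoc act_B act_B act_X;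
  act_mulr :
    act ∘ (1_act_B ⊗₁ mul act_X)
    = mul act_X ∘ (act ⊗₁ act) ∘ mid_swap act_B act_B act_X act_X
      ∘ (comul act_B ⊗₁ (1_act_X ⊗₁ 1_act_X))
}.

Record ActionHom (T T' : Action) := {
  acth_g : BialgHom (act_B T) (act_B T');
  acth_v : BialgHom (act_X T) (act_X T');
  acth_act : acth_v ∘ act T = act T' ∘ (acth_g ⊗₁ acth_v)
}.

Lemma ActionHom_eq (T T' : Action) (f f' : ActionHom T T') :
  acth_g f = acth_g f' -> acth_v f = acth_v f' -> f = f'.
Proof.
  destruct f, f'; simpl; intros -> ->; f_equal; apply proof_irrelevance.
Qed.

Definition action_id (T : Action) : ActionHom T T.
Proof.
  exists (bialg_id (act_B T)) (bialg_id (act_X T)); simpl.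
  now rewrite tensm_id, comp_idl, comp_idr.
Defined.

Definition action_comp (T T' T'' : Action)
  (f' : ActionHom T' T'') (f : ActionHom T T') : ActionHom T T''.
Proof.
  exists (bialg_comp (acth_g f') (acth_g f)) (bialg_comp (acth_v f') (acth_v f)); simpl.
  now rewrite comp_assoc, acth_act, <- comp_assoc, acth_act, comp_assoc, tensm_comp.
Defined.

Definition Act : Category.
Proof.
  refine {| Ob := Action; Hom := ActionHom; idm := action_id; comp := action_comp |};
    intros; apply ActionHom_eq; apply BialgHom_eq; simpl.
  1, 2: apply comp_idl.
  1, 2: apply comp_idr.
  all: apply comp_assoc.
Defined.

End Actions.

(** * Split extensions of associative bialgebras *)

Section SplitExtensions.
Variable C : SymmetricMonoidalCategory.

Record SplitExtension := {
  se_X : Bialgebra C;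
  se_A : Bialgebra C;
  se_B : Bialgebra C;
  kappa : BialgHom se_X se_A;
  alpha : BialgHom se_A se_B;
  sect : BialgHom se_B se_A;
  lambda : Hom se_A se_X;
  lambda_kappa : lambda ∘ kappa = 1_se_X;
  alpha_sect : alpha ∘ sect = 1_se_B;
  lambda_sect : lambda ∘ sect = unit se_X ∘ counit se_B;
  alpha_kappa : alpha ∘ kappa = unit se_B ∘ counit se_X;
  se_decomp :
    mul se_A ∘ ((kappa ∘ lambda) ⊗₁ (sect ∘ alpha)) ∘ comul se_A = 1_se_A;
  lambda_mul :
    lambda ∘ mul se_A ∘ (kappa ⊗₁ sect) = runit se_X ∘ (1_se_X ⊗₁ counit se_B);
  se_cocomm :
    (1_se_B ⊗₁ lambda) ∘ (1_se_B ⊗₁ mul se_A) ∘ (1_se_B ⊗₁ (sect ⊗₁ kappa))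
      ∘ assoc se_B se_B se_X ∘ (comul se_B ⊗₁ 1_se_X)
    = (1_se_B ⊗₁ lambda) ∘ (1_se_B ⊗₁ mul se_A) ∘ (1_se_B ⊗₁ (sect ⊗₁ kappa))
      ∘ assoc se_B se_B se_X ∘ (braid se_B se_B ⊗₁ 1_se_X)
      ∘ (comul se_B ⊗₁ 1_se_X);
  lambda_coalg : is_coalgebra_morphism lambda;
  lambda_unit : preserves_unit lambda
}.

Record SplitExtHom (E E' : SplitExtension) := {
  seh_g : BialgHom (se_B E) (se_B E');
  seh_v : BialgHom (se_X E) (se_X E');
  seh_p : BialgHom (se_A E) (se_A E');
  seh_kappa : seh_p ∘ kappa E = kappa E' ∘ seh_v;
  seh_sect : seh_p ∘ sect E = sect E' ∘ seh_g;
  seh_alpha : alpha E' ∘ seh_p = seh_g ∘ alpha E;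
  seh_lambda : lambda E' ∘ seh_p = seh_v ∘ lambda E
}.

Lemma SplitExtHom_eq (E E' : SplitExtension) (f f' : SplitExtHom E E') :
  seh_g f = seh_g f' -> seh_v f = seh_v f' -> seh_p f = seh_p f' -> f = f'.
Proof.
  destruct f, f'; simpl; intros -> -> ->; f_equal; apply proof_irrelevance.
Qed.

Definition split_ext_id (E : SplitExtension) : SplitExtHom E E.
Proof.
  exists (bialg_id (se_B E)) (bialg_id (se_X E)) (bialg_id (se_A E)); simpl;
    now rewrite comp_idl, comp_idr.
Defined.

Definition split_ext_comp (E E' E'' : SplitExtension)
  (f' : SplitExtHom E' E'') (f : SplitExtHom E E') : SplitExtHom E E''.
Proof.
  exists (bialg_comp (seh_g f') (seh_g f)) (bialg_comp (seh_v f') (seh_v f))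
    (bialg_comp (seh_p f') (seh_p f)); simpl.
  - now rewrite comp_assoc, seh_kappa, <- comp_assoc, seh_kappa, comp_assoc.
  - now rewrite comp_assoc, seh_sect, <- comp_assoc, seh_sect, comp_assoc.
  - now rewrite <- comp_assoc, seh_alpha, comp_assoc, seh_alpha, comp_assoc.
  - now rewrite <- comp_assoc, seh_lambda, comp_assoc, seh_lambda, comp_assoc.
Defined.

Definition SplitExt : Category.
Proof.
  refine {| Ob := SplitExtension; Hom := SplitExtHom;
            idm := split_ext_id; comp := split_ext_comp |};
    intros; apply SplitExtHom_eq; apply BialgHom_eq; simpl.
  1, 2, 3: apply comp_idl.
  1, 2, 3: apply comp_idr.
  all: apply comp_assoc.
Defined.

End SplitExtensions.

(* Main.v *)
Require Import Defs.
From Stdlib Require Import List Permutation Arith Bool ProofIrrelevance.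
Import ListNotations.
Local Open Scope cat_scope.
Set Implicit Arguments.
Unset Strict Implicit.
Unset Printing Implicit Defensive.

(** An action of [B] on [X] gives the smash product bialgebra on [X ⊗ B], in Sweedler notation
    [(x, b) (y, c) = (x (b1 ▷ y), b2 c)], split by the two inclusions and the two counit
    projections; the cocommutativity condition is what makes its comultiplication multiplicative.
    Conversely a split extension gives the action [b ▷ x = λ (e b * κ x)]. Applying
    [m ∘ (κλ ⊗ eα) ∘ Δ = 1] to [e b * κ x] yields [e b * κ x = κ (b1 ▷ x) * e b2], from which
    the action axioms follow, and [x ⊗ b ↦ κ x * e b] is an isomorphism from the smash product
    to [A] with inverse [(λ ⊗ α) ∘ Δ].

    The equations are checked by reflection. A formal morphism is compiled to a straight-line
    program on named wires. A program has at most one denotation, because two composites of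
    braidings realising the same permutation of distinct wires agree, and exchanging independent
    instructions preserves it. Hence formal morphisms whose programs agree up to reordering
    denote equal morphisms. *)

(** * Coherence *)

Lemma precompose (C : Category) (X Y : C) (f g : Hom X Y) :
  f = g -> forall W (k : Hom W X), f ∘ k = g ∘ k.
Proof. now intros ->. Qed.

Ltac ra := repeat rewrite comp_assoc.
(* Rewrites with an equation between composites inside a longer, right-nested composite. *)
Ltac crw H :=
  let E := fresh in
  first
    [ epose proof (precompose H _) as E; rewrite !comp_assoc in E; rewrite E; clear E
    | pose proof H as E; rewrite ?comp_assoc in E; rewrite E; clear E ];
  ra.
Ltac crwl H := crw (eq_sym H).

Local Notation assocI X Y Z := (iso_inv (assoc X Y Z)).

Section Coh.
Variable C : MonoidalCategory.
Implicit Types W X Y Z : C.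

Lemma assocK X Y Z : assocI X Y Z ∘ assoc X Y Z = 1_((X ⊗ Y) ⊗ Z).
Proof. apply iso_invl. Qed.
Lemma assocIK X Y Z : assoc X Y Z ∘ assocI X Y Z = 1_(X ⊗ (Y ⊗ Z)).
Proof. apply iso_invr. Qed.

Lemma lwhisk_comp W X Y Z (g : Hom Y Z) (f : Hom X Y) :
  1_W ⊗₁ (g ∘ f) = (1_W ⊗₁ g) ∘ (1_W ⊗₁ f).
Proof. now rewrite <- tensm_comp, comp_idl. Qed.
Lemma rwhisk_comp W X Y Z (g : Hom Y Z) (f : Hom X Y) :
  (g ∘ f) ⊗₁ 1_W = (g ⊗₁ 1_W) ∘ (f ⊗₁ 1_W).
Proof. now rewrite <- tensm_comp, comp_idl. Qed.
Lemma interchange X X' Y Y' (f : Hom X X') (g : Hom Y Y') :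
  (f ⊗₁ 1_Y') ∘ (1_X ⊗₁ g) = (1_X' ⊗₁ g) ∘ (f ⊗₁ 1_Y).
Proof. now rewrite <- !tensm_comp, !comp_idl, !comp_idr. Qed.

Lemma mono_iso X Y (i : Iso X Y) W (f g : Hom W X) : i ∘ f = i ∘ g -> f = g.
Proof.
  intros H. rewrite <- (comp_idl f), <- (comp_idl g), <- (iso_invl i), !comp_assoc.
  now rewrite H.
Qed.
Lemma epi_iso X Y (i : Iso X Y) W (f g : Hom Y W) : f ∘ i = g ∘ i -> f = g.
Proof.
  intros H. rewrite <- (comp_idr f), <- (comp_idr g), <- (iso_invr i), <- !comp_assoc.
  now rewrite H.
Qed.

Definition iso_tens X X' Y Y' (i : Iso X X') (j : Iso Y Y') : Iso (X ⊗ Y) (X' ⊗ Y').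
Proof.
  exists (i ⊗₁ j) (iso_inv i ⊗₁ iso_inv j);
    now rewrite <- tensm_comp, ?iso_invl, ?iso_invr, tensm_id.
Defined.
Definition iso_id X : Iso X X.
Proof. exists (1_X) (1_X); apply comp_idl. Defined.

Definition iso_comp X Y Z (j : Iso Y Z) (i : Iso X Y) : Iso X Z.
Proof.
  exists (j ∘ i) (iso_inv i ∘ iso_inv j); rewrite comp_assoc.
  - now rewrite <- (comp_assoc (iso_inv j)), iso_invl, comp_idl, iso_invl.
  - now rewrite <- (comp_assoc i), iso_invr, comp_idl, iso_invr.
Defined.

(** The left unitor is natural and invertible, so it conjugates [1_munit ⊗₁ f] to [f]. *)
Lemma lwhisk_unit_faithful X Y (f g : Hom X Y) :
  1_munit ⊗₁ f = 1_munit ⊗₁ g -> f = g.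
Proof.
  intros H. apply (epi_iso (i := lunit X)).
  now rewrite <- !lunit_natural, H.
Qed.
Lemma rwhisk_unit_faithful X Y (f g : Hom X Y) :
  f ⊗₁ 1_munit = g ⊗₁ 1_munit -> f = g.
Proof.
  intros H. apply (epi_iso (i := runit X)).
  now rewrite <- !runit_natural, H.
Qed.

(* Kelly's argument: the two sides agree after tensoring with the unit on the left. *)
Lemma lunit_assoc X Y : lunit (X ⊗ Y) ∘ assoc munit X Y = lunit X ⊗₁ 1_Y.
Proof.
  apply lwhisk_unit_faithful.
  apply (epi_iso (i := assoc munit (munit ⊗ X) Y)).
  apply (epi_iso (i := iso_tens (assoc munit munit X) (iso_id Y))). simpl.
  rewrite <- (assoc_natural (1_munit) (lunit X) (1_Y)).
  ra. rewrite <- rwhisk_comp, triangle.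
  rewrite lwhisk_comp, comp_assoc, <- (comp_assoc (1_munit ⊗₁ assoc _ _ _)).
  rewrite pentagon, <- comp_assoc, triangle.
  now rewrite <- (tensm_id X Y), assoc_natural.
Qed.

End Coh.

(** * Transpositions in front of a right-nested product *)

Section Swap.
Variable C : SymmetricMonoidalCategory.
Implicit Types W X Y Z : C.

(** Contexts of wires are right-nested products, so this exchanges two adjacent wires with the rest
    of the context behind them. *)
Definition swap X Y Z : Hom (X ⊗ (Y ⊗ Z)) (Y ⊗ (X ⊗ Z)) :=
  assoc Y X Z ∘ (braid X Y ⊗₁ 1_Z) ∘ assocI X Y Z.

Lemma assocI_natural X X' Y Y' Z Z' (f : Hom X X') (g : Hom Y Y') (h : Hom Z Z') :
  assocI X' Y' Z' ∘ (f ⊗₁ (g ⊗₁ h)) = ((f ⊗₁ g) ⊗₁ h) ∘ assocI X Y Z.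
Proof.
  apply (epi_iso (i := assoc X Y Z)). apply (mono_iso (i := assoc X' Y' Z')). ra.
  rewrite assocK, comp_idr, assoc_natural. crw (assocIK X' Y' Z'). now rewrite comp_idl.
Qed.

Lemma swap_natural X X' Y Y' Z Z' (f : Hom X X') (g : Hom Y Y') (h : Hom Z Z') :
  swap X' Y' Z' ∘ (f ⊗₁ (g ⊗₁ h)) = (g ⊗₁ (f ⊗₁ h)) ∘ swap X Y Z.
Proof.
  unfold swap. ra. rewrite assocI_natural. rewrite <- (comp_assoc (braid X' Y' ⊗₁ _)).
  rewrite <- tensm_comp, braid_natural, comp_idl.
  rewrite <- (comp_idr h) at 1. rewrite tensm_comp. ra.
  rewrite <- (comp_assoc (assoc _ _ _)), assoc_natural. now ra.
Qed.

Lemma swapK X Y Z : swap Y X Z ∘ swap X Y Z = 1_(X ⊗ (Y ⊗ Z)).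
Proof.
  unfold swap. ra. crw (assocK Y X Z). rewrite comp_idl.
  rewrite <- (comp_assoc (braid Y X ⊗₁ _)), <- rwhisk_comp, braid_sym, tensm_id, comp_idl.
  apply assocIK.
Qed.

Definition swap_iso X Y Z : Iso (X ⊗ (Y ⊗ Z)) (Y ⊗ (X ⊗ Z)).
Proof. exists (swap X Y Z) (swap Y X Z); apply swapK. Defined.

Lemma pentagonI W X Y Z :
  assocI W X (Y ⊗ Z) ∘ (1_W ⊗₁ assoc X Y Z) =
  assoc (W ⊗ X) Y Z ∘ (assocI W X Y ⊗₁ 1_Z) ∘ assocI W (X ⊗ Y) Z.
Proof.
  apply (mono_iso (i := assoc W X (Y ⊗ Z))).
  apply (epi_iso (i := assoc W (X ⊗ Y) Z)).
  apply (epi_iso (i := iso_tens (assoc W X Y) (iso_id Z))). simpl.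
  ra. crw (assocIK W X (Y ⊗ Z)). rewrite comp_idl, <- comp_assoc, pentagon.
  crw (assocK W (X ⊗ Y) Z). rewrite comp_idl, <- rwhisk_comp, assocK, tensm_id.
  now rewrite comp_idr.
Qed.

(** This is the hexagon, carried over to right-nested products by two uses of the pentagon and one
    of [pentagonI]. *)
Lemma swap_tens_r X Y Y' Z :
  assoc Y Y' (X ⊗ Z) ∘ swap X (Y ⊗ Y') Z =
  (1_Y ⊗₁ swap X Y' Z) ∘ swap X Y (Y' ⊗ Z) ∘ (1_X ⊗₁ assoc Y Y' Z).
Proof.
  apply (epi_iso (i := assoc X (Y ⊗ Y') Z)).
  apply (epi_iso (i := iso_tens (assoc X Y Y') (iso_id Z))). simpl.
  unfold swap. ra.
  crw (assocK X (Y ⊗ Y') Z). rewrite comp_idl.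
  crwl (pentagon Y Y' X Z).
  rewrite <- !rwhisk_comp.
  pose proof (hexagon X Y Y') as hex. rewrite !comp_assoc in hex. rewrite hex.
  rewrite !rwhisk_comp. ra.
  crw (pentagonI X Y Y' Z). crw (assocK X (Y ⊗ Y') Z). rewrite comp_idl.
  assert (K : (assocI X Y Y' ⊗₁ 1_Z) ∘ (assoc X Y Y' ⊗₁ 1_Z) = 1_(((X ⊗ Y) ⊗ Y') ⊗ Z))
    by now rewrite <- rwhisk_comp, assocK, tensm_id.
  rewrite K, comp_idr.
  crw (assoc_natural (1_Y) (braid X Y') (1_Z)).
  pose proof (assoc_natural (braid X Y) (1_Y') (1_Z)) as N. rewrite tensm_id in N.
  rewrite <- N, !lwhisk_comp. ra.
  crwl (pentagon Y X Y' Z).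
  assert (K' : (1_Y ⊗₁ assocI X Y' Z) ∘ (1_Y ⊗₁ assoc X Y' Z) = 1_(Y ⊗ ((X ⊗ Y') ⊗ Z)))
    by now rewrite <- lwhisk_comp, assocK, tensm_id.
  crw K'. now rewrite comp_idl.
Qed.

(** Inverting [swap_tens_r] suffices: by symmetry, the inverse of a swap is the opposite swap. *)
Lemma swap_tens_l X X' Y Z :
  (1_Y ⊗₁ assoc X X' Z) ∘ swap (X ⊗ X') Y Z =
  swap X Y (X' ⊗ Z) ∘ (1_X ⊗₁ swap X' Y Z) ∘ assoc X X' (Y ⊗ Z).
Proof.
  apply (epi_iso (i := swap_iso Y (X ⊗ X') Z)). simpl. ra.
  rewrite swapK, comp_idr. pose proof (swap_tens_r Y X X' Z) as E. rewrite !comp_assoc in E.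
  rewrite E. rewrite <- (comp_assoc (1_X ⊗₁ _)), <- lwhisk_comp, swapK, tensm_id, comp_idl.
  rewrite <- comp_assoc, swapK. now rewrite comp_idl.
Qed.

Lemma swap_assoc X Y Z : swap X Y Z ∘ assoc X Y Z = assoc Y X Z ∘ (braid X Y ⊗₁ 1_Z).
Proof. unfold swap. ra. now rewrite assocK, comp_idr. Qed.

Local Opaque swap.

(* Up to unitors, swapping with [munit ≅ munit ⊗ munit] is idempotent; as it is invertible,
   it is the identity. *)
Lemma swap_unit_r X Z : lunit (X ⊗ Z) ∘ swap X munit Z = 1_X ⊗₁ lunit Z.
Proof.
  assert (E : lunit (X ⊗ (munit ⊗ Z)) ∘ swap X munit (munit ⊗ Z) = 1_X ⊗₁ lunit (munit ⊗ Z)).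
  { apply (mono_iso (i := swap_iso X munit Z)). simpl.
    apply (epi_iso (i := iso_tens (iso_id X) (assoc munit munit Z))). simpl.
    ra. rewrite <- lwhisk_comp, lunit_assoc, swap_natural, tensm_id, <- lunit_assoc.
    ra. pose proof (swap_tens_r X munit munit Z) as E. rewrite E. ra.
crwl (lunit_natural (swap X munit Z)). reflexivity. }
  (* [E] has [munit ⊗ Z] in place of [Z]; naturality along [lunit Z] removes the extra unit. *)
  apply (epi_iso (i := iso_tens (iso_id X) (iso_tens (iso_id munit) (lunit Z)))). simpl.
  ra. rewrite swap_natural. crw (lunit_natural (1_X ⊗₁ lunit Z)). rewrite E.
  now rewrite <- !lwhisk_comp, lunit_natural.
Qed.

Lemma swap_unit_l X Z : (1_X ⊗₁ lunit Z) ∘ swap munit X Z = lunit (X ⊗ Z).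
Proof.
  rewrite <- swap_unit_r. ra. now rewrite swapK, comp_idr.
Qed.

(* Naturality of the swap of [X] past [Y ⊗ Z] along the braiding of [Y] and [Z]. *)
Lemma yang_baxter X Y Z T :
  (1_Z ⊗₁ swap X Y T) ∘ (swap X Z (Y ⊗ T) ∘ (1_X ⊗₁ swap Y Z T)) =
  swap Y Z (X ⊗ T) ∘ ((1_Y ⊗₁ swap X Z T) ∘ swap X Y (Z ⊗ T)).
Proof.
  apply (epi_iso (i := iso_tens (iso_id X) (assoc Y Z T))). simpl.
  pose proof (swap_natural (1_X) (braid Y Z) (1_T)) as N.
  apply (f_equal (fun q => assoc Z Y (X ⊗ T) ∘ q)) in N.
  rewrite tensm_id in N. rewrite <- !comp_assoc, swap_tens_r in N. rewrite !comp_assoc in N.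
  pose proof (swap_tens_r X Y Z T) as E. rewrite !comp_assoc in E.
  ra. rewrite <- E. rewrite <- lwhisk_comp, swap_assoc, lwhisk_comp. rewrite N.
  now crwl (swap_assoc Y Z (X ⊗ T)).
Qed.
End Swap.

(** * Programs on named wires *)

Inductive ty := At (s : nat) | One | Ten (a b : ty).

(** One name per atom, arranged as in the type, so that inputs and outputs are addressed by name and
    not by position. *)
Fixpoint wires (a : ty) : Type :=
  match a with At _ => nat | One => Datatypes.unit | Ten a b => (wires a * wires b)%type end.

(** A sort, which selects the object carried, and a name. Wires of different sorts are distinct even
    under the same name. *)
Definition wire := (nat * nat)%type.
Definition wire_dec (x y : wire) : {x = y} + {x <> y}.
Proof. decide equality; apply Nat.eq_dec. Defined.

(** With the context as an accumulator the result forgets bracketing and units, so associators and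
    unitors will act as identities on contexts. *)
Fixpoint flat (a : ty) : wires a -> list wire -> list wire :=
  match a with
  | At s => fun n Γ => (s, n) :: Γ
  | One => fun _ Γ => Γ
  | Ten a b => fun t Γ => flat (fst t) (flat (snd t) Γ)
  end.
Definition disj (Γ Δ : list wire) : Prop := forall x, In x Γ -> ~ In x Δ.

Section Diagrams.
Variable C : SymmetricMonoidalCategory.
Variable o : nat -> C.

Fixpoint dty (a : ty) : C :=
  match a with At s => o s | One => munit | Ten a b => dty a ⊗ dty b end.
Fixpoint dctx (Γ : list wire) : C :=
  match Γ with [] => munit | x :: Γ => o (fst x) ⊗ dctx Γ end.

Fixpoint flat_iso (a : ty) : forall (t : wires a) Γ, Iso (dty a ⊗ dctx Γ) (dctx (flat t Γ)) :=
  match a with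
  | At s => fun n Γ => iso_id _
  | One => fun _ Γ => lunit (dctx Γ)
  | Ten a b => fun t Γ =>
      iso_comp (flat_iso (fst t) (flat (snd t) Γ))
        (iso_comp (iso_tens (iso_id (dty a)) (flat_iso (snd t) Γ))
          (assoc (dty a) (dty b) (dctx Γ)))
  end.
Notation split t Γ := (iso_mor (flat_iso t Γ)).
Notation merge t Γ := (iso_inv (flat_iso t Γ)).

Lemma splitK a (t : wires a) Γ : merge t Γ ∘ split t Γ = 1_(dty a ⊗ dctx Γ).
Proof. apply iso_invl. Qed.
Lemma mergeK a (t : wires a) Γ : split t Γ ∘ merge t Γ = 1_(dctx (flat t Γ)).
Proof. apply iso_invr. Qed.

Definition rest a (t : wires a) Γ Δ (f : Hom (dctx Γ) (dctx Δ)) :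
  Hom (dctx (flat t Γ)) (dctx (flat t Δ)) :=
  split t Δ ∘ (1_(dty a) ⊗₁ f) ∘ merge t Γ.
Definition box a b (f : Hom (dty a) (dty b)) (t : wires a) (t' : wires b) Γ :
  Hom (dctx (flat t Γ)) (dctx (flat t' Γ)) :=
  split t' Γ ∘ (f ⊗₁ 1_(dctx Γ)) ∘ merge t Γ.
Definition cross a b (t : wires a) (t' : wires b) Γ :
  Hom (dctx (flat t (flat t' Γ))) (dctx (flat t' (flat t Γ))) :=
  split t' (flat t Γ) ∘ (1_(dty b) ⊗₁ split t Γ) ∘ swap (dty a) (dty b) (dctx Γ)
  ∘ (1_(dty a) ⊗₁ merge t' Γ) ∘ merge t (flat t' Γ).

(* Requiring [x <> y] keeps equal wires in order, so that the contexts determine the morphism even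
   when a wire is repeated. *)
Inductive perm : forall Γ Δ, Hom (dctx Γ) (dctx Δ) -> Prop :=
| perm_id Γ : @perm Γ Γ (1_(dctx Γ))
| perm_swap x y Γ : x <> y ->
    @perm (x :: y :: Γ) (y :: x :: Γ) (swap (o (fst x)) (o (fst y)) (dctx Γ))
| perm_skip x Γ Δ f : perm f -> @perm (x :: Γ) (x :: Δ) (1_(o (fst x)) ⊗₁ f)
| perm_comp Γ Δ Θ (g : Hom (dctx Δ) (dctx Θ)) (f : Hom (dctx Γ) (dctx Δ)) :
    perm f -> perm g -> perm (g ∘ f).

(** * Uniqueness of the morphism realising a permutation of wires *)

Lemma perm_Permutation Γ Δ (f : Hom (dctx Γ) (dctx Δ)) : perm f -> Permutation Γ Δ.
Proof. induction 1; eauto using Permutation. Qed.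

Fixpoint rem (x : wire) (Γ : list wire) : list wire :=
  match Γ with
  | [] => []
  | y :: Γ => if wire_dec x y then Γ else y :: rem x Γ
  end.
(** The canonical permutation bringing the first [x] to the front, crossing only wires other than
    [x]. Arbitrary permutations are compared through it. *)
Fixpoint pull (x : wire) (Γ : list wire) :
  option (Hom (dctx Γ) (o (fst x) ⊗ dctx (rem x Γ))) :=
  match Γ with
  | [] => None
  | y :: Γ =>
      match wire_dec x y as d return
        option (Hom (o (fst y) ⊗ dctx Γ)
          (o (fst x) ⊗ dctx (if d then Γ else y :: rem x Γ))) with
      | left e => 
          Some (match e in _ = y return Hom (o (fst y) ⊗ dctx Γ) (o (fst x) ⊗ dctx Γ) with
                | eq_refl => 1_(o (fst x) ⊗ dctx Γ) end)
      | right _ => option_map (fun p => swap _ _ _ ∘ (1_(o (fst y)) ⊗₁ p)) (pull x Γ)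
      end
  end.

Local Opaque swap.
(** Extracting a wire is natural with respect to permutations. For a transposition of two wires both
    different from [x] this is the Yang-Baxter equation; for one that involves [x] it follows from
    the definition of [pull] and [swapK]. *)
Lemma pull_perm Γ Δ (f : Hom (dctx Γ) (dctx Δ)) : perm f ->
  forall x p', pull x Δ = Some p' ->
  exists p f', pull x Γ = Some p /\ @perm (rem x Γ) (rem x Δ) f' /\
    p' ∘ f = (1_(o (fst x)) ⊗₁ f') ∘ p.
Proof.
  induction 1 as [Γ|y z Γ ne|y Γ Δ f P IH|Γ Δ Θ g f _ IHf _ IHg]; intros x p' E.
  - exists p', (1_(dctx (rem x Γ))). split; [assumption|split; [apply perm_id|]].
    now rewrite tensm_id, comp_idl, comp_idr.
  - simpl in *. destruct (wire_dec x z) as [e|nz], (wire_dec x y) as [e'|ny].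
    + congruence.
    + destruct e. injection E as <-. 
      exists (swap _ _ _ ∘ (1_(o (fst y)) ⊗₁ 1_(o (fst x) ⊗ dctx Γ))), (1_(dctx (y :: Γ))).
      split; [|split; [apply perm_id|]].
      * destruct (wire_dec x x) as [e|]; [|congruence].
        (* The transport inside [pull] reduces only along [eq_refl]. *)
        now rewrite ?(proof_irrelevance _ e eq_refl).
      * simpl. now rewrite !tensm_id, !comp_idr, ?comp_idl, ?comp_idr.
    + destruct e'. destruct (wire_dec x x) as [e|]; [|congruence].
      rewrite ?(proof_irrelevance _ e eq_refl) in E. simpl in E. injection E as <-.
      eexists _, (1_(dctx (z :: Γ))). split; [reflexivity|split; [apply perm_id|]].
      simpl. now rewrite !tensm_id, !comp_idr, swapK.
    + simpl in E. destruct (wire_dec x y); [congruence|]. destruct (wire_dec x z); [congruence|].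
      destruct (pull x Γ) as [p|]; [|discriminate]. simpl in *. injection E as <-.
      eexists _, (swap _ _ _). split; [reflexivity|split; [now apply perm_swap|]].
      rewrite !lwhisk_comp. ra.
      rewrite <- (swap_natural (1_(o (fst y))) (1_(o (fst z))) p).
      crw (yang_baxter (o (fst y)) (o (fst z)) (o (fst x)) (dctx (rem x Γ))).
      reflexivity.
  - simpl in *. destruct (wire_dec x y) as [e|ny].
    + destruct e. injection E as <-. eexists _, f.
      split; [reflexivity|split; [assumption|]]. now rewrite comp_idl, comp_idr.
    + specialize (IH x). destruct (pull x Δ) as [q'|]; [|discriminate]. injection E as <-.
      destruct (IH q' eq_refl) as (q & f' & Eq & P' & N). rewrite Eq. simpl.
      eexists _, (1_(o (fst y)) ⊗₁ f'). split; [reflexivity|split; [now apply perm_skip|]].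
      ra. rewrite <- lwhisk_comp, N, lwhisk_comp.
      crw (swap_natural (1_(o (fst y))) (1_(o (fst x))) f').
      reflexivity.
  - destruct (IHg x p' E) as (q & g' & Eq & Pg & Ng).
    destruct (IHf x q Eq) as (p & f' & Ep & Pf & Nf).
    exists p, (g' ∘ f'). split; [assumption|split; [exact (perm_comp Pf Pg)|]].
    rewrite <- comp_assoc, Ng, comp_assoc, Nf, lwhisk_comp. now ra.
Qed.

(** This is [pull_perm] for the head of the target, where pulling is the identity. *)
Lemma perm_cons_inv Γ Δ x (f : Hom (dctx Γ) (dctx (x :: Δ))) : perm f ->
  exists p f', pull x Γ = Some p /\ @perm (rem x Γ) Δ f' /\ f = (1_(o (fst x)) ⊗₁ f') ∘ p.
Proof.
  intros P. pose proof (pull_perm P (x := x)) as Q. simpl in Q.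
  destruct (wire_dec x x) as [e|]; [|congruence].
  rewrite ?(proof_irrelevance _ e eq_refl) in Q.
  destruct (Q _ eq_refl) as (p & f' & Ep & Pf & N). exists p, f'.
  now rewrite comp_idl in N.
Qed.

Lemma perm_cons_cancel Γ Δ x (f : Hom (dctx (x :: Γ)) (dctx (x :: Δ))) : perm f ->
  exists f', @perm Γ Δ f' /\ f = 1_(o (fst x)) ⊗₁ f'.
Proof.
  intros P. destruct (perm_cons_inv P) as (p & f' & Ep & Pf & ->). clear P. revert p f' Ep Pf.
  simpl. destruct (wire_dec x x) as [e|]; [|congruence].
  rewrite ?(proof_irrelevance _ e eq_refl). intros p f' Ep Pf. injection Ep as <-.
  exists f'. now rewrite comp_idr.
Qed.

(** The match ranges over all shapes because induction on [perm] needs general indices; excluding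
    the mixed shapes forces the middle context of a composite to be empty too. *)
Lemma perm_nil Γ Δ (f : Hom (dctx Γ) (dctx Δ)) : perm f ->
  match Γ, Δ return Hom (dctx Γ) (dctx Δ) -> Prop with
  | [], [] => fun f => f = 1_munit
  | _ :: _, _ :: _ => fun _ => True
  | _, _ => fun _ => False
  end f.
Proof.
  induction 1 as [[]| | |Γ Δ Θ g f _ IHf _ IHg]; simpl; trivial.
  destruct Γ, Δ, Θ; simpl in *; trivial; try easy. now rewrite IHf, IHg, comp_idl.
Qed.

(** Induction on the target: both permutations factor through the same [pull] of its head wire, and
    what follows permutes shorter contexts. *)
Theorem perm_unique Γ Δ (f g : Hom (dctx Γ) (dctx Δ)) : perm f -> perm g -> f = g.
Proof.
  revert Γ f g. induction Δ as [|x Δ IH]; intros Γ f g Pf Pg.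
  - apply perm_nil in Pf, Pg. destruct Γ; [congruence|easy].
  - destruct (perm_cons_inv Pf) as (p & f' & Ep & Pf' & ->).
    destruct (perm_cons_inv Pg) as (q & g' & Eq & Pg' & ->).
    rewrite (IH _ _ _ Pf' Pg'). congruence.
Qed.

Lemma perm_exists Γ Δ : Permutation Γ Δ -> exists f, @perm Γ Δ f.
Proof.
  induction 1 as [|x Γ Δ _ [f IH]|x y Γ|Γ Δ Θ _ [f IHf] _ [g IHg]].
  - eexists. apply perm_id.
  - eexists. apply perm_skip, IH.
  (* Equal wires may not be transposed, but then both contexts coincide and the identity serves. *)
  - destruct (wire_dec x y) as [->|ne]; eexists; [apply perm_id|].
    apply perm_swap. congruence.
  - eexists. apply (perm_comp IHf IHg).
Qed.

(** * Blocks of wires in front of a context *)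

Lemma rest_id a (t : wires a) Γ : rest t (1_(dctx Γ)) = 1_(dctx (flat t Γ)).
Proof. unfold rest. now rewrite tensm_id, comp_idr, mergeK. Qed.

Lemma rest_comp a (t : wires a) Γ Δ Θ (g : Hom (dctx Δ) (dctx Θ)) (f : Hom (dctx Γ) (dctx Δ)) :
  rest t (g ∘ f) = rest t g ∘ rest t f.
Proof.
  unfold rest. ra. crw (splitK t Δ). now rewrite comp_idl, lwhisk_comp, !comp_assoc.
Qed.

Lemma rest_At s n Γ Δ (f : Hom (dctx Γ) (dctx Δ)) :
  rest (n : wires (At s)) f = 1_(o s) ⊗₁ f.
Proof. unfold rest. simpl. now rewrite comp_idl, comp_idr. Qed.

Lemma rest_One t Γ Δ (f : Hom (dctx Γ) (dctx Δ)) : rest (a := One) t f = f.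
Proof.
  unfold rest. simpl. rewrite lunit_natural, comp_assoc, iso_invr. apply comp_idr.
Qed.

Lemma rest_Ten a b t u Γ Δ (f : Hom (dctx Γ) (dctx Δ)) :
  rest ((t, u) : wires (Ten a b)) f = rest t (rest u f).
Proof.
  unfold rest. simpl. rewrite !lwhisk_comp, <- (tensm_id (dty a) (dty b)). ra.
  crw (assoc_natural (1_(dty a)) (1_(dty b)) f).
  crw (assocIK (dty a) (dty b) (dctx Γ)). now rewrite comp_idl.
Qed.

Lemma perm_rest a (t : wires a) Γ Δ (f : Hom (dctx Γ) (dctx Δ)) : perm f -> perm (rest t f).
Proof.
  revert t Γ Δ f. induction a as [s| |a IHa b IHb]; intros t Γ Δ f P.
  - rewrite rest_At. now apply (perm_skip (s, t)).
  - now rewrite rest_One.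
  - destruct t as [t u]. rewrite rest_Ten. apply IHa, IHb, P.
Qed.

(** Equal wires keep their order, so a permutation fixes a common front block even when its wires
    recur in the tail. *)
Lemma perm_rest_cancel a (t : wires a) Γ Δ (f : Hom (dctx (flat t Γ)) (dctx (flat t Δ))) :
  perm f -> exists f', @perm Γ Δ f' /\ f = rest t f'.
Proof.
  revert t Γ Δ f. induction a as [s| |a IHa b IHb]; intros t Γ Δ f P.
  - destruct (perm_cons_cancel P) as (f' & P' & ->). exists f'. now rewrite rest_At.
  - exists f. now rewrite rest_One.
  - destruct t as [t u]. destruct (IHa _ _ _ _ P) as (f1 & P1 & ->).
    destruct (IHb _ _ _ _ P1) as (f2 & P2 & ->). exists f2. now rewrite rest_Ten.
Qed.

Lemma crossK a b (t : wires a) (u : wires b) Γ :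
  cross u t Γ ∘ cross t u Γ = 1_(dctx (flat t (flat u Γ))).
Proof.
  unfold cross. ra. crw (splitK u (flat t Γ)). rewrite comp_idl.
  rewrite <- (comp_assoc (1_(dty b) ⊗₁ merge t Γ)), <- lwhisk_comp, splitK, tensm_id, comp_idl.
  crw (swapK (dty a) (dty b) (dctx Γ)). rewrite comp_idl.
  rewrite <- (comp_assoc (1_(dty a) ⊗₁ _)), <- lwhisk_comp, mergeK, tensm_id, comp_idl.
  apply mergeK.
Qed.

Lemma cross_One_l t b (u : wires b) Γ :
  cross (t : wires One) u Γ = 1_(dctx (flat u Γ)).
Proof.
  unfold cross. simpl. ra. crw (swap_unit_l (dty b) (dctx Γ)).
  rewrite <- (comp_assoc (lunit _)), lunit_natural. ra. rewrite iso_invr, comp_idr.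
  apply mergeK.
Qed.

Lemma cross_Ten_l a b c t u (v : wires c) Γ :
  cross ((t, u) : wires (Ten a b)) v Γ = cross t v (flat u Γ) ∘ rest t (cross u v Γ).
Proof.
  unfold cross, rest. simpl. ra. crw (splitK t (flat v (flat u Γ))). rewrite comp_idl.
  rewrite !lwhisk_comp. ra.
  crw (swap_tens_l (dty a) (dty b) (dty c) (dctx Γ)).
  rewrite <- (comp_assoc (1_(dty a) ⊗₁ merge v (flat u Γ))), <- lwhisk_comp.
  rewrite splitK, tensm_id, comp_idl.
  crw (swap_natural (1_(dty a)) (1_(dty c)) (split u Γ)).
  rewrite <- (tensm_id (dty a) (dty b)).
  crw (assoc_natural (1_(dty a)) (1_(dty b)) (merge v Γ)).
  crw (assocIK (dty a) (dty b) (dctx (flat v Γ))). now rewrite comp_idl.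
Qed.

(** A crossing is the inverse of the opposite one, so the rules for the second block follow from
    those for the first. *)
Lemma cross_inv a b (t : wires a) (u : wires b) Γ f :
  cross u t Γ ∘ f = 1_(dctx (flat t (flat u Γ))) -> cross t u Γ = f.
Proof.
  intros E. rewrite <- (comp_idr (cross t u Γ)), <- E, <- comp_assoc, crossK.
  apply comp_idl.
Qed.

Lemma cross_One_r a (t : wires a) u Γ : cross t (u : wires One) Γ = 1_(dctx (flat t Γ)).
Proof. apply cross_inv. now rewrite cross_One_l, comp_idl. Qed.

Lemma cross_Ten_r a b c (t : wires c) u v Γ :
  cross t ((u, v) : wires (Ten a b)) Γ = rest u (cross t v Γ) ∘ cross t u (flat v Γ).
Proof.
  apply cross_inv. rewrite cross_Ten_l. ra.
  rewrite <- (comp_assoc (rest u _)), <- rest_comp, crossK, rest_id, comp_idl.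
  apply (crossK t u (flat v Γ)).
Qed.

Lemma in_flat a (t : wires a) Γ x : In x (flat t Γ) <-> In x (flat t []) \/ In x Γ.
Proof.
  revert t Γ. induction a as [s| |a IHa b IHb]; intros t Γ; simpl.
  - tauto.
  - tauto.
  - rewrite IHa, IHb, (IHa _ (flat (snd t) [])). tauto.
Qed.

Lemma disj_Ten_l a b (t : wires (Ten a b)) Γ :
  disj (flat t []) Γ -> disj (flat (fst t) []) Γ /\ disj (flat (snd t) []) Γ.
Proof.
  intros D. split; intros x Hx; apply D; simpl; apply in_flat; tauto.
Qed.

Lemma disj_sym Γ Δ : disj Γ Δ -> disj Δ Γ.
Proof. intros D x Hx Hy. exact (D x Hy Hx). Qed.

(** A block crossing decomposes into transpositions of single wires; disjointness makes each of them
    a transposition of distinct wires. *)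
Lemma perm_cross a b (t : wires a) (u : wires b) Γ :
  disj (flat t []) (flat u []) -> perm (cross t u Γ).
Proof.
  revert t b u Γ. induction a as [s| |a IHa a' IHa']; intros t b u Γ D.
  - revert u Γ D. induction b as [s'| |b IHb b' IHb']; intros u Γ D.
    + unfold cross. simpl. rewrite !tensm_id, !comp_idl, !comp_idr.
      apply (@perm_swap (s, t) (s', u)). intros E. apply (D (s, t)); simpl; auto.
    + rewrite cross_One_r. apply perm_id.
    + destruct u as [u u']. rewrite cross_Ten_r.
      apply disj_sym, disj_Ten_l in D. destruct D as [D D'].
      refine (perm_comp (IHb _ _ _) (perm_rest _ (IHb' _ _ _))); now apply disj_sym.
  - rewrite cross_One_l. apply perm_id.
  - destruct t as [t t']. rewrite cross_Ten_l. apply disj_Ten_l in D. destruct D as [D D'].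
    exact (perm_comp (perm_rest _ (IHa' _ _ _ _ D')) (IHa _ _ _ _ D)).
Qed.

Lemma box_id a (t : wires a) Γ : box (1_(dty a)) t t Γ = 1_(dctx (flat t Γ)).
Proof. unfold box. now rewrite tensm_id, comp_idr, mergeK. Qed.

Lemma box_comp a b c (g : Hom (dty b) (dty c)) (f : Hom (dty a) (dty b)) t u v Γ :
  box (g ∘ f) t v Γ = box g u v Γ ∘ box f t u Γ.
Proof.
  unfold box. ra. crw (splitK u Γ). now rewrite comp_idl, rwhisk_comp, !comp_assoc.
Qed.

Lemma box_rest a b (f : Hom (dty a) (dty b)) t u Γ Δ (k : Hom (dctx Γ) (dctx Δ)) :
  box f t u Δ ∘ rest t k = rest u k ∘ box f t u Γ.
Proof.
  unfold box, rest. ra. crw (splitK t Δ). crw (splitK u Γ). rewrite !comp_idl.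
  now crw (interchange f k).
Qed.

Lemma cross_box a b c (f : Hom (dty a) (dty b)) t t' (u : wires c) Γ :
  cross t' u Γ ∘ box f t t' (flat u Γ) = rest u (box f t t' Γ) ∘ cross t u Γ.
Proof.
  unfold cross, box, rest. ra. crw (splitK t' (flat u Γ)). crw (splitK u (flat t Γ)).
  rewrite !comp_idl, !lwhisk_comp. ra.
  rewrite <- (comp_assoc (1_(dty c) ⊗₁ merge t Γ)), <- lwhisk_comp, splitK, tensm_id, comp_idl.
  crwl (interchange f (merge u Γ)). rewrite <- (tensm_id (dty c) (dctx Γ)).
  crw (swap_natural f (1_(dty c)) (1_(dctx Γ))). reflexivity.
Qed.

(* Labels only guide the search for matching instructions. *)
Record instr := Instr {
  label : nat;
  idom : ty;
  icod : ty;
  imor : Hom (dty idom) (dty icod);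
  ins : wires idom;
  outs : wires icod
}.

(* A relation rather than a function: ill-scoped programs denote nothing. *)
Fixpoint Sem (P : list instr) Γ c (z : wires c) : Hom (dctx Γ) (dty c) -> Prop :=
  match P with
  | [] => fun h => exists f, @perm Γ (flat z []) f /\ h = runit (dty c) ∘ (merge z [] ∘ f)
  | i :: P => fun h => exists R f k,
      @perm Γ (flat (ins i) R) f /\ @Sem P (flat (outs i) R) c z k /\
      h = k ∘ (box (imor i) (ins i) (outs i) R ∘ f)
  end.

(** * Programs denote at most one morphism *)

Lemma Sem_perm P Γ Δ c (z : wires c) f h : @perm Γ Δ f -> @Sem P Δ c z h -> Sem P z (h ∘ f).
Proof.
  destruct P as [|i P]; simpl.
  - intros Pf (p & Pp & ->). exists (p ∘ f). split; [exact (perm_comp Pf Pp)|now ra].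
  - intros Pf (R & p & k & Pp & S & ->). exists R, (p ∘ f), k.
    split; [exact (perm_comp Pf Pp)|split; [assumption|now ra]].
Qed.

(** The permutation [f] is there for the induction: two denotations may choose different leftover
    contexts for an instruction. By [perm_rest_cancel] these differ by a permutation of the tail,
    which slides past the box. *)
Lemma Sem_unique_perm P Γ Δ c (z : wires c) f h k :
  @perm Γ Δ f -> Sem P z h -> Sem P z k -> h = k ∘ f.
Proof.
  revert Γ Δ f h k. induction P as [|i P IH]; simpl; intros Γ Δ f h k Pf Sh Sk.
  - destruct Sh as (p & Pp & ->), Sk as (q & Pq & ->). ra.
    now rewrite (perm_unique Pp (perm_comp Pf Pq)).
  - destruct Sh as (R & p & h' & Pp & Sh & ->), Sk as (R' & q & k' & Pq & Sk & ->).
    assert (exists r, @perm (flat (ins i) R) (flat (ins i) R') r) as [r Pr].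
    { apply perm_exists. rewrite <- (perm_Permutation Pp), <- (perm_Permutation Pq).
      apply (perm_Permutation Pf). }
    pose proof (perm_unique (perm_comp Pp Pr) (perm_comp Pf Pq)) as E.
    destruct (perm_rest_cancel Pr) as (r' & Pr' & ->).
    rewrite (IH _ _ _ _ _ (perm_rest (outs i) Pr') Sh Sk). ra. rewrite <- E.
    now crw (box_rest (imor i) (ins i) (outs i) r').
Qed.

Lemma Sem_unique P Γ c (z : wires c) (h k : Hom (dctx Γ) (dty c)) :
  Sem P z h -> Sem P z k -> h = k.
Proof.
  intros Sh Sk. rewrite (Sem_unique_perm (perm_id Γ) Sh Sk). apply comp_idr.
Qed.

(** * Reordering of independent instructions *)

Definition disjb a b (t : wires a) (u : wires b) : bool :=
  forallb (fun x => forallb (fun y => if wire_dec x y then false else true) (flat u []))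
    (flat t []).
Lemma disjbP a b (t : wires a) (u : wires b) : disjb t u = true -> disj (flat t []) (flat u []).
Proof.
  unfold disjb. rewrite forallb_forall. intros H x Hx Hy. specialize (H x Hx).
  rewrite forallb_forall in H. specialize (H x Hy). now destruct (wire_dec x x).
Qed.

(** Each of the four pairs of blocks is crossed in the proof of [Sem_swap]. *)
Definition independent (i j : instr) : bool :=
  disjb (ins i) (ins j) && disjb (ins i) (outs j) && disjb (outs i) (ins j)
  && disjb (outs i) (outs j).

(** For an instruction with inputs [t] that uses none of the outputs [Γ] of its predecessor: its
    inputs lie among the wires [R] left over by the predecessor, and [Q] is what neither touches. *)
Lemma Permutation_flat_inv a (t : wires a) Γ R R' :
  disj (flat t []) Γ -> Permutation (Γ ++ R) (flat t R') ->
  exists Q, Permutation R (flat t Q) /\ Permutation R' (Γ ++ Q).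
Proof.
  revert t Γ R R'. induction a as [s| |a IHa b IHb]; intros t Γ R R' D P.
  - simpl in *. assert (In (s, t) R) as I.
    { assert (In (s, t) (Γ ++ R)) as I by (rewrite P; now left).
      apply in_app_or in I. destruct I as [I|I]; [|assumption].
      exfalso. apply (D (s, t)); simpl; auto. }
    apply in_split in I. destruct I as (R1 & R2 & ->). exists (R1 ++ R2). split.
    + symmetry. apply Permutation_middle.
    + symmetry. apply Permutation_cons_inv with (s, t). rewrite <- P.
      rewrite Permutation_middle. apply Permutation_app_head, Permutation_middle.
  - exists R. now split.
  - apply disj_Ten_l in D. destruct D as [D D'].
    destruct (IHa _ _ _ _ D P) as (Q1 & P1 & P2).
    destruct (IHb _ _ _ _ D' (Permutation_sym P2)) as (Q2 & P3 & P4).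
    exists Q2. split; [|assumption]. simpl. rewrite P1.
    (* [perm_rest] shows that [flat] respects permutations of the tail. *)
    assert (exists f, @perm Q1 (flat (snd t) Q2) f) as [f Pf] by now apply perm_exists.
    apply (perm_Permutation (perm_rest (fst t) Pf)).
Qed.

Lemma flat_app a (t : wires a) Γ : flat t Γ = flat t [] ++ Γ.
Proof.
  revert t Γ. induction a as [s| |a IHa b IHb]; intros t Γ; simpl; trivial.
  rewrite IHa, IHb, (IHa _ (flat (snd t) [])). apply app_assoc.
Qed.

Lemma Sem_swap i j P Γ c (z : wires c) (h : Hom (dctx Γ) (dty c)) :
  independent i j = true -> Sem (i :: j :: P) z h -> Sem (j :: i :: P) z h.
Proof.
  unfold independent. rewrite !andb_true_iff. intros [[[D1 D2] D3] D4].
  apply disjbP in D1, D2, D3, D4.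
  simpl. intros (R & f & k & Pf & (R' & g & l & Pg & S & ->) & ->).
  pose proof (perm_Permutation Pg) as Pm. rewrite flat_app in Pm.
  destruct (Permutation_flat_inv (disj_sym D3) Pm) as (Q & E1 & E2).
  rewrite <- flat_app in E2. symmetry in E2.
  destruct (perm_exists E1) as [u Pu], (perm_exists E2) as [v Pv].
  (* When [j] runs first, the inputs of [i] are still in front of the untouched wires [Q]. *)
  exists (flat (ins i) Q), (cross (ins i) (ins j) Q ∘ (rest (ins i) u ∘ f)).
  exists (l ∘ (rest (outs j) v ∘ (cross (outs i) (outs j) Q
    ∘ (box (imor i) (ins i) (outs i) (flat (outs j) Q) ∘ cross (outs j) (ins i) Q)))).
  split; [|split].
  - exact (perm_comp (perm_comp Pf (perm_rest _ Pu)) (perm_cross _ D1)).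
  - exists (flat (outs j) Q), (cross (outs j) (ins i) Q).
    exists (l ∘ (rest (outs j) v ∘ cross (outs i) (outs j) Q)).
    split; [now apply perm_cross, disj_sym|split; [|now ra]].
    apply Sem_perm with (2 := S). exact (perm_comp (perm_cross _ D4) (perm_rest _ Pv)).
  (* Uniqueness of permutations replaces [g] by a route through [Q]; the boxes then slide past the
     crossings by naturality. *)
  - rewrite (perm_unique Pg
      (perm_comp (perm_comp (perm_rest (outs i) Pu) (perm_cross Q D3)) (perm_rest (ins j) Pv))).
    ra. f_equal.
    crw (box_rest (imor j) (ins j) (outs j) v). f_equal.
    crwl (box_rest (imor i) (ins i) (outs i) u).
    crw (cross_box (imor i) (ins i) (outs i) (outs j) Q).
    rewrite <- (comp_assoc (cross (ins i) (outs j) Q)), crossK, comp_idl.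
    crwl (box_rest (imor j) (ins j) (outs j) (box (imor i) (ins i) (outs i) Q)).
    now crw (cross_box (imor i) (ins i) (outs i) (ins j) Q).
Qed.

Fixpoint extract (k : nat) (P : list instr) : option (instr * list instr) :=
  match k, P with
  | _, [] => None
  | 0, i :: P => Some (i, P)
  | S k, i :: P =>
      match extract k P with
      | Some (j, P) => if independent i j then Some (j, i :: P) else None
      | None => None
      end
  end.
(* Each position in [ks] refers to the instructions not yet moved. *)
Fixpoint reorder (ks : list nat) (P : list instr) : option (list instr) :=
  match ks with
  | [] => match P with [] => Some [] | _ => None end
  | k :: ks =>
      match extract k P with
      | Some (i, P) => option_map (cons i) (reorder ks P)
      | None => None
      end
  end.

Lemma Sem_cons i P Q c (z : wires c) :
  (forall Γ (h : Hom (dctx Γ) (dty c)), Sem P z h -> Sem Q z h) ->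
  forall Γ (h : Hom (dctx Γ) (dty c)), Sem (i :: P) z h -> Sem (i :: Q) z h.
Proof.
  intros H Γ h (R & f & k & Pf & S & ->). exists R, f, k. auto.
Qed.

Lemma Sem_extract k P j Q c (z : wires c) Γ (h : Hom (dctx Γ) (dty c)) :
  extract k P = Some (j, Q) -> Sem P z h -> Sem (j :: Q) z h.
Proof.
  revert P Q Γ h. induction k as [|k IH]; intros [|i P] Q Γ h E; try discriminate; simpl in E.
  - now injection E as -> ->.
  - destruct (extract k P) as [[j' P']|] eqn:E'; [|discriminate].
    destruct (independent i j') eqn:I; [|discriminate]. injection E as -> <-.
    intros S. apply Sem_swap; [assumption|]. revert Γ h S. apply Sem_cons.
    intros Γ h. now apply IH.
Qed.

Lemma Sem_reorder ks P Q c (z : wires c) Γ (h : Hom (dctx Γ) (dty c)) :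
  reorder ks P = Some Q -> Sem P z h -> Sem Q z h.
Proof.
  revert P Q Γ h. induction ks as [|k ks IH]; intros P Q Γ h E S; simpl in E.
  - destruct P; [now injection E as <-|discriminate].
  - destruct (extract k P) as [[i P']|] eqn:E'; [|discriminate].
    destruct (reorder ks P') as [Q'|] eqn:E''; [|discriminate]. injection E as <-.
    generalize (Sem_extract E' S). apply Sem_cons. intros Δ k'. now apply IH.
Qed.

(** * Formal morphisms and their compilation *)

Inductive tm : ty -> ty -> Type :=
| Id a : tm a a
| Comp a b c (g : tm b c) (f : tm a b) : tm a c
| Tens a a' b b' (f : tm a a') (g : tm b b') : tm (Ten a b) (Ten a' b')
| Assoc a b c : tm (Ten (Ten a b) c) (Ten a (Ten b c))
| AssocI a b c : tm (Ten a (Ten b c)) (Ten (Ten a b) c)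
| Lunit a : tm (Ten One a) a
| LunitI a : tm a (Ten One a)
| Runit a : tm (Ten a One) a
| RunitI a : tm a (Ten a One)
| Braid a b : tm (Ten a b) (Ten b a)
| Gen (l : nat) a b (f : Hom (dty a) (dty b)) : tm a b.

Fixpoint den a b (f : tm a b) : Hom (dty a) (dty b) :=
  match f with
  | Id a => 1_(dty a)
  | Comp g f => den g ∘ den f
  | Tens f g => den f ⊗₁ den g
  | Assoc a b c => assoc (dty a) (dty b) (dty c)
  | AssocI a b c => iso_inv (assoc (dty a) (dty b) (dty c))
  | Lunit a => lunit (dty a)
  | LunitI a => iso_inv (lunit (dty a))
  | Runit a => runit (dty a)
  | RunitI a => iso_inv (runit (dty a))
  | Braid a b => braid (dty a) (dty b)
  | Gen _ f => f
  end.

(** An exhausted supply yields the name 0; repeated names can at worst make the checks in [isotopy]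
    fail. *)
Fixpoint fresh (a : ty) (ν : list nat) : wires a * list nat :=
  match a with
  | At _ => (hd 0 ν, tl ν)
  | One => (tt, ν)
  | Ten a b => let (t, ν) := fresh a ν in let (u, ν) := fresh b ν in ((t, u), ν)
  end.

(* The names supplied to [compile] are arbitrary; [ok] records whether they were distinct enough
   for every crossing of wires to be meaningful. *)
Record code b := Code { body : list instr; out : wires b; supply : list nat; ok : bool }.

(** Structural morphisms emit no instruction and only rearrange names, so coherence is absorbed
    here. *)
Fixpoint compile a b (f : tm a b) : wires a -> list nat -> code b :=
  match f with
  | Id a => fun t ν => Code (b := a) [] t ν true
  | Comp g f => fun t ν =>
      let cf := compile f t ν in let cg := compile g (out cf) (supply cf) in
      Code (body cf ++ body cg) (out cg) (supply cg) (ok cf && ok cg)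
  | @Tens a a' b b' f g => fun t ν =>
      let cf := compile f (fst t) ν in let cg := compile g (snd t) (supply cf) in
      Code (b := Ten a' b') (body cf ++ body cg) (out cf, out cg) (supply cg)
        (ok cf && ok cg && disjb (out cf) (snd t) && disjb (out cf) (out cg))
  | Assoc a b c => fun t ν =>
      Code (b := Ten a (Ten b c)) [] (fst (fst t), (snd (fst t), snd t)) ν true
  | AssocI a b c => fun t ν =>
      Code (b := Ten (Ten a b) c) [] ((fst t, fst (snd t)), snd (snd t)) ν true
  | Lunit a => fun t ν => Code [] (snd t) ν true
  | LunitI a => fun t ν => Code (b := Ten One a) [] (tt, t) ν true
  | Runit a => fun t ν => Code [] (fst t) ν true
  | RunitI a => fun t ν => Code (b := Ten a One) [] (t, tt) ν true
  | Braid a b => fun t ν => Code (b := Ten b a) [] (snd t, fst t) ν (disjb (fst t) (snd t))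
  | @Gen l a b f => fun t ν =>
      let (u, ν) := fresh b ν in Code [Instr l f t u] u ν true
  end.

Lemma box_inv a b (f : Hom (dty a) (dty b)) (g : Hom (dty b) (dty a)) t u Γ k :
  f ∘ g = 1_(dty b) -> box f t u Γ = k -> k ∘ box g u t Γ = 1_(dctx (flat u Γ)).
Proof. intros E <-. now rewrite <- box_comp, E, box_id. Qed.

(** Both bracketings flatten to the same context, and the pentagon makes the associator act on it as
    the identity. *)
Lemma box_assoc a b c (t : wires a) (u : wires b) (v : wires c) Γ :
  box (assoc (dty a) (dty b) (dty c) : Hom (dty (Ten (Ten a b) c)) (dty (Ten a (Ten b c))))
    ((t, u), v) (t, (u, v)) Γ = 1_(dctx (flat t (flat u (flat v Γ)))).
Proof.
  unfold box. simpl. rewrite !lwhisk_comp. ra.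
  pose proof (pentagon (dty a) (dty b) (dty c) (dctx Γ)) as E. rewrite !comp_assoc in E.
  crw E. clear E.
  crw (assocIK (dty a ⊗ dty b) (dty c) (dctx Γ)). rewrite comp_idl.
  rewrite <- (tensm_id (dty a) (dty b)).
  crw (assoc_natural (1_(dty a)) (1_(dty b)) (merge v Γ)).
  crw (assocIK (dty a) (dty b) (dctx (flat v Γ))). rewrite comp_idl.
  rewrite <- (comp_assoc (1_(dty a) ⊗₁ (1_(dty b) ⊗₁ _))), <- !lwhisk_comp.
  rewrite mergeK, !tensm_id, comp_idl.
  rewrite <- (comp_assoc (1_(dty a) ⊗₁ _)), <- !lwhisk_comp.
  rewrite mergeK, tensm_id, comp_idl. apply mergeK.
Qed.

Lemma box_assocI a b c (t : wires a) (u : wires b) (v : wires c) Γ :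
  box (assocI (dty a) (dty b) (dty c) : Hom (dty (Ten a (Ten b c))) (dty (Ten (Ten a b) c)))
    (t, (u, v)) ((t, u), v) Γ = 1_(dctx (flat t (flat u (flat v Γ)))).
Proof.
  rewrite <- (comp_idl (box _ _ _ _)).
  exact (box_inv (a := Ten (Ten a b) c) (b := Ten a (Ten b c))
    (assocIK (dty a) (dty b) (dty c)) (box_assoc t u v Γ)).
Qed.

Lemma box_lunit a (t : wires a) Γ :
  box (lunit (dty a) : Hom (dty (Ten One a)) (dty a)) (tt, t) t Γ = 1_(dctx (flat t Γ)).
Proof.
  unfold box. simpl. ra. rewrite <- lunit_assoc. ra.
  crw (assocIK munit (dty a) (dctx Γ)). rewrite comp_idl.
  crw (lunit_natural (merge t Γ)). rewrite iso_invr, comp_idr. apply mergeK.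
Qed.

Lemma box_lunitI a (t : wires a) Γ :
  box (iso_inv (lunit (dty a)) : Hom (dty a) (dty (Ten One a))) t (tt, t) Γ = 1_(dctx (flat t Γ)).
Proof.
  rewrite <- (comp_idl (box _ _ _ _)). 
  exact (box_inv (a := Ten One a) (b := a) (iso_invr (lunit (dty a))) (box_lunit t Γ)).
Qed.

Lemma box_runit a (t : wires a) Γ :
  box (runit (dty a) : Hom (dty (Ten a One)) (dty a)) (t, tt) t Γ = 1_(dctx (flat t Γ)).
Proof.
  unfold box. simpl. ra. rewrite <- triangle. ra.
  crw (assocIK (dty a) munit (dctx Γ)). rewrite comp_idl.
  rewrite <- (comp_assoc (1_(dty a) ⊗₁ _)), <- !lwhisk_comp.
  rewrite iso_invr, tensm_id, comp_idl. apply mergeK.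
Qed.

Lemma box_runitI a (t : wires a) Γ :
  box (iso_inv (runit (dty a)) : Hom (dty a) (dty (Ten a One))) t (t, tt) Γ = 1_(dctx (flat t Γ)).
Proof.
  rewrite <- (comp_idl (box _ _ _ _)). 
  exact (box_inv (a := Ten a One) (b := a) (iso_invr (runit (dty a))) (box_runit t Γ)).
Qed.

Lemma box_braid a b (t : wires a) (u : wires b) Γ :
  box (braid (dty a) (dty b) : Hom (dty (Ten a b)) (dty (Ten b a))) (t, u) (u, t) Γ = cross t u Γ.
Proof.
  unfold box, cross. simpl. ra. crwl (swap_assoc (dty a) (dty b) (dctx Γ)).
  crw (assocIK (dty a) (dty b) (dctx Γ)). now rewrite comp_idl.
Qed.

Lemma box_Ten a a' b b' (f : Hom (dty a) (dty a')) (g : Hom (dty b) (dty b')) t t' u u' Γ :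
  box (f ⊗₁ g : Hom (dty (Ten a b)) (dty (Ten a' b'))) (t, u) (t', u') Γ =
  rest t' (box g u u' Γ) ∘ box f t t' (flat u Γ).
Proof.
  unfold box, rest. simpl. ra. crw (splitK t' (flat u Γ)). rewrite comp_idl.
  crw (assoc_natural f g (1_(dctx Γ))). crw (assocIK (dty a) (dty b) (dctx Γ)).
  rewrite comp_idl, !lwhisk_comp. ra.
  crwl (interchange f (merge u Γ)).
  crwl (interchange f (g ⊗₁ 1_(dctx Γ))).
  assert (E : f ⊗₁ (g ⊗₁ 1_(dctx Γ)) =
    (f ⊗₁ 1_(dty b' ⊗ dctx Γ)) ∘ (1_(dty a) ⊗₁ (g ⊗₁ 1_(dctx Γ))))
    by now rewrite <- tensm_comp, comp_idl, comp_idr.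
  rewrite E. now ra.
Qed.

(** Stated with a continuation [P] of meaning [h] and a tail [Γ], so that composition becomes
    concatenation and each tensor factor can carry the other in its tail. *)
Theorem compile_sound a b (f : tm a b) t ν : ok (compile f t ν) = true ->
  forall P Γ c (z : wires c) h, Sem (Γ := flat (out (compile f t ν)) Γ) P z h ->
  Sem (body (compile f t ν) ++ P) z (h ∘ box (den f) t (out (compile f t ν)) Γ).
Proof.
  revert t ν.
  induction f as [a|a b c g IHg f IHf|a a' b b' f IHf g IHg|a b c|a b c|a|a|a|a|a b|l a b f];
    intros t ν; simpl; intros O P Γ c' z h S.
  - now rewrite box_id, comp_idr.
  - apply andb_prop in O. destruct O as [Of Og]. rewrite <- app_assoc.
    rewrite (box_comp _ _ _ (out (compile f t ν))), <- comp_assoc.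
    apply IHf, IHg; assumption.
  - rewrite !andb_true_iff in O. destruct O as [[[Of Og] D1] D2].
    apply disjbP in D1, D2. destruct t as [t u]. simpl in *.
    set (cf := compile f t ν) in *. set (cg := compile g u (supply cf)) in *.
    rewrite <- app_assoc, box_Ten.
    (* The code of [f] runs first; then the inputs of [g] are crossed to the front, [g] runs, and
       its outputs are crossed back. *)
    pose proof (Sem_perm (perm_cross Γ (disj_sym D2)) S) as S1.
    pose proof (Sem_perm (perm_cross Γ D1) (IHg _ _ Og _ _ _ _ _ S1)) as S2.
    assert (E : h ∘ (rest (out cf) (box (den g) u (out cg) Γ)
        ∘ box (den f) t (out cf) (flat u Γ)) =
      h ∘ cross (out cg) (out cf) Γ ∘ box (den g) u (out cg) (flat (out cf) Γ)
        ∘ cross (out cf) u Γ ∘ box (den f) t (out cf) (flat u Γ)).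
    { ra. crw (cross_box (den g) u (out cg) (out cf) Γ). crw (crossK (out cf) u Γ).
      now rewrite comp_idl. }
    rewrite E. exact (IHf _ _ Of _ _ _ _ _ S2).
  - destruct t as [[t u] v]. rewrite box_assoc, comp_idr. exact S.
  - destruct t as [t [u v]]. rewrite box_assocI, comp_idr. exact S.
  - destruct t as [[] t]. rewrite box_lunit, comp_idr. exact S.
  - rewrite box_lunitI, comp_idr. exact S.
  - destruct t as [t []]. rewrite box_runit, comp_idr. exact S.
  - rewrite box_runitI, comp_idr. exact S.
  - apply disjbP in O. destruct t as [t u]. rewrite box_braid.
    exact (Sem_perm (perm_cross Γ O) S).
  - destruct (fresh b ν) as [u ν'] eqn:E. simpl in *.
    exists Γ, (1_(dctx (flat t Γ))), h. split; [apply perm_id|split; [assumption|]].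
    now rewrite comp_idr.
Qed.

(** After reordering, both terms compile to one program on the same wires, and this has at most one
    denotation. *)
Theorem isotopy a b (f g : tm a b) t ν ν' ks :
  ok (compile f t ν) = true -> ok (compile g t ν') = true ->
  out (compile f t ν) = out (compile g t ν') ->
  reorder ks (body (compile f t ν)) = Some (body (compile g t ν')) ->
  den f = den g.
Proof.
  intros Of Og Eo Er.
  (* The empty program, which returns the outputs, continues both compilations. *)
  assert (S : Sem [] (out (compile f t ν))
    (runit (dty b)
     ∘ (merge (out (compile f t ν)) [] ∘ 1_(dctx (flat (out (compile f t ν)) []))))).
  { exists (1_(dctx (flat (out (compile f t ν)) []))). split; [apply perm_id|reflexivity]. }
  pose proof (compile_sound Of S) as Sf. rewrite app_nil_r in Sf.
  apply (Sem_reorder Er) in Sf. rewrite Eo in S, Sf.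
  pose proof (compile_sound Og S) as Sg. rewrite app_nil_r in Sg.
  pose proof (Sem_unique Sf Sg) as E.
  set (z := out (compile g t ν')) in *. rewrite comp_idr, !comp_assoc in E.
  (* The tail is empty, so cancelling coherence isomorphisms leaves the desired equation tensored
     with the unit. *)
  apply mono_iso in E. unfold box in E. rewrite <- !comp_assoc, splitK, !comp_idl in E.
  apply (f_equal (fun k => k ∘ split t [])) in E. rewrite !comp_assoc, splitK, !comp_idr in E.
  exact (rwhisk_unit_faithful E).
Qed.

End Diagrams.

(** * Rewriting diagrams *)

(* The results of these functions need no correctness proof: [isotopy] validates them. *)
Section Search.
Variable C : SymmetricMonoidalCategory.
Variable o : nat -> C.

Fixpoint names (a : ty) : wires a -> list nat :=
  match a with
  | At _ => fun n => [n]
  | One => fun _ => []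
  | Ten a b => fun t => names (fst t) ++ names (snd t)
  end.
Fixpoint rename (ρ : nat -> nat) (a : ty) : wires a -> wires a :=
  match a with
  | At _ => ρ
  | One => fun t => t
  | Ten a b => fun t => (rename ρ (fst t), rename ρ (snd t))
  end.
Fixpoint width (a : ty) : nat :=
  match a with At _ => 1 | One => 0 | Ten a b => width a + width b end.
Fixpoint demand a b (f : tm o a b) : nat :=
  match f with
  | Comp g f => demand g + demand f
  | Tens f g => demand f + demand g
  | @Gen _ _ _ _ b _ => width b
  | _ => 0
  end.

Definition inputs (a : ty) : wires a := fst (fresh a (seq 0 (width a))).
Definition default_supply a b (f : tm o a b) : list nat := seq (width a) (demand f).
Definition program a b (f : tm o a b) : code o b := compile f (inputs a) (default_supply f).

Definition assignment := list (nat * nat).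
Fixpoint lookup (σ : assignment) (n : nat) : option nat :=
  match σ with
  | [] => None
  | (m, k) :: σ => if n =? m then Some k else lookup σ n
  end.
Definition bind (σ : assignment) (n k : nat) : option assignment :=
  match lookup σ n with
  | Some k' => if k =? k' then Some σ else None
  | None => Some ((n, k) :: σ)
  end.
Fixpoint binds (σ : assignment) (ns ks : list nat) : option assignment :=
  match ns, ks with
  | [], [] => Some σ
  | n :: ns, k :: ks => match bind σ n k with Some σ => binds σ ns ks | None => None end
  | _, _ => None
  end.
Definition match_instr (σ : assignment) (j i : instr o) : option assignment :=
  if label j =? label i then
    binds σ (names (ins j) ++ names (outs j)) (names (ins i) ++ names (outs i))
  else None.

Fixpoint picks A (l : list A) : list (nat * A * list A) :=
  match l with
  | [] => []
  | x :: l => (0, x, l) :: map (fun '(n, y, l') => (S n, y, x :: l')) (picks l)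
  end.

Fixpoint embeddings (σ : assignment) (Q P : list (instr o)) :
  list (assignment * list nat * list (instr o)) :=
  match Q with
  | [] => [(σ, [], P)]
  | j :: Q =>
      flat_map (fun '(k, i, P') =>
        match match_instr σ j i with
        | Some σ => map (fun '(σ, ks, R) => (σ, k :: ks, R)) (embeddings σ Q P')
        | None => []
        end) (picks P)
  end.

Definition apply_to (σ : assignment) (n : nat) : nat :=
  match lookup σ n with Some k => k | None => 0 end.

(** The names returned are a supply for compiling [g] with the wire names of [f]; the positions list
    the instructions of [f] in the order of [g]. Inputs are matched to themselves. *)
Definition align a b (f g : tm o a b) : option (list nat * list nat) :=
  let P := program f in
  let Q := program g in
  let id := combine (names (inputs a)) (names (inputs a)) in
  let good := filter (fun '(σ, _, _) =>
      if list_eq_dec Nat.eq_dec (map (apply_to σ) (names (out Q))) (names (out P))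
      then true else false) (embeddings id (body Q) (body P)) in
  match good with
  | [] => None
  | (σ, ks, _) :: _ =>
      Some (map (apply_to σ) (flat_map (fun i => names (outs i)) (body Q)), ks)
  end.

Fixpoint context_ty (Γ : list wire) : ty :=
  match Γ with [] => One | x :: Γ => Ten (At (fst x)) (context_ty Γ) end.

Definition swap_tm a b c : tm o (Ten a (Ten b c)) (Ten b (Ten a c)) :=
  Comp (Assoc o b a c) (Comp (Tens (Braid o a b) (Id o c)) (AssocI o a b c)).

Fixpoint flat_tm (a : ty) :
  forall (t : wires a) Γ, tm o (Ten a (context_ty Γ)) (context_ty (flat t Γ)) :=
  match a with
  | At s => fun n Γ => Id o _
  | One => fun _ Γ => Lunit o _
  | Ten a b => fun t Γ =>
      Comp (flat_tm (fst t) (flat (snd t) Γ))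
        (Comp (Tens (Id o a) (flat_tm (snd t) Γ)) (Assoc o a b (context_ty Γ)))
  end.

Fixpoint pull_tm (x : wire) (Γ : list wire) :
  option {R & tm o (context_ty Γ) (Ten (At (fst x)) (context_ty R))} :=
  match Γ with
  | [] => None
  | y :: Γ =>
      match wire_dec x y with
      | left e =>
          Some (existT _ Γ
            match e in _ = y return tm o (Ten (At (fst y)) _) (Ten (At (fst x)) _) with
            | eq_refl => Id o _
            end)
      | right _ =>
          match pull_tm x Γ with
          | Some (existT _ R p) => Some (existT _ (y :: R) (Comp (swap_tm _ _ _) (Tens (Id o _) p)))
          | None => None
          end
      end
  end.

Fixpoint take_tm (a : ty) :
  forall (t : wires a) Γ, option {R & tm o (context_ty Γ) (Ten a (context_ty R))} :=
  match a with
  | At s => fun n Γ => pull_tm (s, n) Γ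
  | One => fun _ Γ => Some (existT _ Γ (LunitI o _))
  | Ten a b => fun t Γ =>
      match take_tm (fst t) Γ with
      | Some (existT _ R p) =>
          match take_tm (snd t) R with
          | Some (existT _ R' q) =>
              Some (existT _ R' (Comp (AssocI o _ _ _) (Comp (Tens (Id o _) q) p)))
          | None => None
          end
      | None => None
      end
  end.

Fixpoint run_tm (P : list (instr o)) Γ : option {Δ & tm o (context_ty Γ) (context_ty Δ)} :=
  match P with
  | [] => Some (existT _ Γ (Id o _))
  | i :: P =>
      match take_tm (ins i) Γ with
      | Some (existT _ R p) =>
          match run_tm P (flat (outs i) R) with
          | Some (existT _ Δ q) =>
              Some (existT _ Δ (Comp q (Comp (flat_tm (outs i) R)
                (Comp (Tens (Gen (label i) (imor i)) (Id o _)) p))))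
          | None => None
          end
      | None => None
      end
  end.

Fixpoint dependent (used : list nat) (P : list (instr o)) : list (instr o) * list (instr o) :=
  match P with
  | [] => ([], [])
  | i :: P =>
      if existsb (fun n => existsb (Nat.eqb n) used) (names (ins i)) then
        let (Q, R) := dependent (names (outs i) ++ used) P in (Q, i :: R)
      else let (Q, R) := dependent used P in (i :: Q, R)
  end.

(** A factorisation around a hole from [c] to [d]; [R] lists the wires passing beside the hole. *)
Definition redex a b c d :=
  {R & (tm o a (Ten c (context_ty R)) * tm o (Ten d (context_ty R)) b)%type}.

(** Instructions that do not depend on the matched ones [L] run before the hole, all others after
    it. *)
Definition factor a b c d (t : wires a) (P : list (instr o)) (z : wires b)
  (u : wires c) (L : list (instr o)) (v : wires d) : option (redex a b c d) :=
  let (Q, S) := dependent (flat_map (fun i => names (outs i)) L) P in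
  match run_tm Q (flat t []) with
  | Some (existT _ Γ p) =>
      match take_tm u Γ with
      | Some (existT _ R q) =>
          match run_tm S (flat v R) with
          | Some (existT _ Δ r) =>
              match take_tm z Δ with
              | Some (existT _ [] s) =>
                  Some (existT _ R
                    (Comp q (Comp p (Comp (flat_tm t []) (RunitI o _))),
                     Comp (Runit o _) (Comp s (Comp r (flat_tm v R)))))
              | _ => None
              end
          | None => None
          end
      | None => None
      end
  | None => None
  end.

Definition redexes a b c d (f : tm o a b) (l : tm o c d) : list (redex a b c d) :=
  let P := program f in
  let L := program l in
  flat_map (fun '(σ, _, R) =>
    let L' := map (fun i => Instr (label i) (imor i) (rename (apply_to σ) (ins i))
                              (rename (apply_to σ) (outs i))) (body L) in
    match factor (inputs a) R (out P) (rename (apply_to σ) (inputs c)) L'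
            (rename (apply_to σ) (out L)) with
    | Some r => [r]
    | None => []
    end) (embeddings [] (body L) (body P)).

Lemma rewrite_redex a b c d (f g : tm o a b) (l r : tm o c d) R
  (p : tm o a (Ten c (context_ty R))) (q : tm o (Ten d (context_ty R)) b) :
  den l = den r ->
  den f = den (Comp q (Comp (Tens l (Id o (context_ty R))) p)) ->
  den (Comp q (Comp (Tens r (Id o (context_ty R))) p)) = den g ->
  den f = den g.
Proof. simpl. intros E -> <-. now rewrite E. Qed.
End Search.

(** Reification produces only indices within the list, so the default is never read. *)
Definition objs (C : SymmetricMonoidalCategory) (l : list C) (n : nat) : C := nth n l munit.

(** * Reification of equations between morphisms *)

Ltac index x l :=
  match l with
  | cons x _ => constr:(0)
  | cons _ ?l => let n := index x l in constr:(S n)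
  end.
Ltac gen_index f gs :=
  match gs with
  | (f, _) => constr:(0)
  | (_, ?gs) => let n := gen_index f gs in constr:(S n)
  end.
Ltac reify_ob os X :=
  lazymatch X with
  | munit => constr:(One)
  | ?X ⊗ ?Y => let a := reify_ob os X in let b := reify_ob os Y in constr:(Ten a b)
  | _ => let n := index X os in constr:(At n)
  end.
Ltac reify_mor os gs f :=
  let o := constr:(objs os) in
  let ob X := reify_ob os X in
  lazymatch f with
  | idm ?X => let a := ob X in constr:(Id o a)
  | ?g ∘ ?f => let g := reify_mor os gs g in let f := reify_mor os gs f in constr:(Comp g f)
  | ?f ⊗₁ ?g => let f := reify_mor os gs f in let g := reify_mor os gs g in constr:(Tens f g)
  | iso_mor (assoc ?X ?Y ?Z) =>
      let a := ob X in let b := ob Y in let c := ob Z in constr:(Assoc o a b c)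
  | iso_inv (assoc ?X ?Y ?Z) =>
      let a := ob X in let b := ob Y in let c := ob Z in constr:(AssocI o a b c)
  | iso_mor (lunit ?X) => let a := ob X in constr:(Lunit o a)
  | iso_inv (lunit ?X) => let a := ob X in constr:(LunitI o a)
  | iso_mor (runit ?X) => let a := ob X in constr:(Runit o a)
  | iso_inv (runit ?X) => let a := ob X in constr:(RunitI o a)
  | braid ?X ?Y => let a := ob X in let b := ob Y in constr:(Braid o a b)
  | mid_swap _ _ _ _ => let f := eval unfold mid_swap in f in reify_mor os gs f
  | _ =>
      let l := gen_index f gs in
      lazymatch type of f with
      | Hom ?X ?Y =>
          let a := ob X in let b := ob Y in constr:(@Gen _ o l a b f)
      end
  end.

Ltac reify_goal os gs :=
  lazymatch goal with
  | |- ?f = ?g =>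
      let f := reify_mor os gs f in let g := reify_mor os gs g in
      change (den f = den g)
  end.

Ltac solve_isotopy :=
  lazymatch goal with
  | |- @den _ _ ?a _ ?f = den ?g =>
      let r := eval vm_compute in (align f g) in
      lazymatch r with
      | Some (?ν, ?ks) =>
          apply (@isotopy _ _ _ _ f g (inputs a) (default_supply f) ν ks); vm_compute; reflexivity
      end
  end.

(* Rewrites the [n]-th occurrence of the left-hand side of [H] in the left-hand side of the goal;
   [os] and [gs] list the objects and morphisms treated as atoms. *)
Ltac rewrite_diagram os gs n H :=
  let T := type of H in
  let T := eval cbv beta delta
    [preserves_mul preserves_unit preserves_comul preserves_counit] in T in
  lazymatch T with
  | ?l = ?r =>
      let l := reify_mor os gs l in let r := reify_mor os gs r in
      lazymatch goal with
      | |- den ?f = den ?g =>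
          let x := eval vm_compute in (nth_error (redexes f l) n) in
          lazymatch x with
          | Some (existT _ ?R (?p, ?q)) =>
              refine (@rewrite_redex _ _ _ _ _ _ f g l r R p q H _ _); [solve_isotopy|]
          | None => fail "no redex"
          end
      end
  end.

Ltac simp_bialgebra rw A := first
  [ rw (mul_unitl A) | rw (mul_unitr A) | rw (comul_unit A) | rw (counit_unit A)
  | rw (comul_counitl A) | rw (comul_counitr A) | rw (counit_mul A) ].

(** * The smash product *)

Section Smash.
Variable C : SymmetricMonoidalCategory.
Variable T : Action C.
Notation X := (act_X T).
Notation B := (act_B T).

(** In Sweedler notation, $b ⊗ y ↦ (b_1 ▷ y) ⊗ b_2$. *)
Definition smash_swap : Hom (B ⊗ X) (X ⊗ B) :=
  (act T ⊗₁ 1_B) ∘ iso_inv (assoc B X B) ∘ (1_B ⊗₁ braid B X) ∘ assoc B B X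
  ∘ (comul B ⊗₁ 1_X).
Definition smash_mul : Hom ((X ⊗ B) ⊗ (X ⊗ B)) (X ⊗ B) :=
  (mul X ⊗₁ mul B) ∘ iso_inv (assoc X X (B ⊗ B))
  ∘ (1_X ⊗₁ (assoc X B B ∘ (smash_swap ⊗₁ 1_B) ∘ iso_inv (assoc B X B)))
  ∘ assoc X B (X ⊗ B).
Definition smash_unit : Hom munit (X ⊗ B) := (unit X ⊗₁ unit B) ∘ iso_inv (lunit munit).
Definition smash_comul : Hom (X ⊗ B) ((X ⊗ B) ⊗ (X ⊗ B)) :=
  mid_swap X X B B ∘ (comul X ⊗₁ comul B).
Definition smash_counit : Hom (X ⊗ B) munit := lunit munit ∘ (counit X ⊗₁ counit B).

Ltac objects := constr:([carrier X; carrier B]).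
Ltac generators := constr:((mul X, (unit X, (comul X, (counit X,
  (mul B, (unit B, (comul B, (counit B, (act T, tt)))))))))).
Ltac diagram :=
  unfold smash_mul, smash_unit, smash_comul, smash_counit, smash_swap;
  let os := objects in let gs := generators in reify_goal os gs.
Ltac rw_at n H := let os := objects in let gs := generators in rewrite_diagram os gs n H.
Ltac rw H := rw_at 0 H.
Ltac simp_units := repeat first
  [ simp_bialgebra rw constr:(X) | simp_bialgebra rw constr:(B)
  | rw (act_unitl T) | rw (act_unitr T) | rw (act_counit T) ].
(** Normal form: comultiplications move towards the inputs, and iterated products and coproducts are
    bracketed to the right. *)
Ltac simp_all := simp_units; repeat first
  [ rw (comul_mul X) | rw (comul_mul B) | rw (act_comul T) | rw (act_mull T) | rw (act_mulr T)
  | rw (mul_assoc X) | rw (mul_assoc B) | rw (comul_coassoc X) | rw (comul_coassoc B) ].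

Lemma smash_mul_assoc :
  smash_mul ∘ (smash_mul ⊗₁ 1_(X ⊗ B)) =
  smash_mul ∘ (1_(X ⊗ B) ⊗₁ smash_mul) ∘ assoc (X ⊗ B) (X ⊗ B) (X ⊗ B).
Proof. diagram. simp_all. symmetry. simp_all. solve_isotopy. Qed.

Lemma smash_mul_unitl : smash_mul ∘ (smash_unit ⊗₁ 1_(X ⊗ B)) = lunit (X ⊗ B).
Proof. diagram. simp_units. solve_isotopy. Qed.

Lemma smash_mul_unitr : smash_mul ∘ (1_(X ⊗ B) ⊗₁ smash_unit) = runit (X ⊗ B).
Proof. diagram. simp_units. solve_isotopy. Qed.

Lemma smash_comul_coassoc :
  assoc (X ⊗ B) (X ⊗ B) (X ⊗ B) ∘ (smash_comul ⊗₁ 1_(X ⊗ B)) ∘ smash_comul =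
  (1_(X ⊗ B) ⊗₁ smash_comul) ∘ smash_comul.
Proof. diagram. simp_all. solve_isotopy. Qed.

Lemma smash_comul_counitl :
  lunit (X ⊗ B) ∘ (smash_counit ⊗₁ 1_(X ⊗ B)) ∘ smash_comul = 1_(X ⊗ B).
Proof. diagram. simp_units. solve_isotopy. Qed.

Lemma smash_comul_counitr :
  runit (X ⊗ B) ∘ (1_(X ⊗ B) ⊗₁ smash_counit) ∘ smash_comul = 1_(X ⊗ B).
Proof. diagram. simp_units. solve_isotopy. Qed.

Lemma smash_comul_unit :
  smash_comul ∘ smash_unit = (smash_unit ⊗₁ smash_unit) ∘ iso_inv (lunit munit).
Proof. diagram. simp_units. solve_isotopy. Qed.

Lemma smash_counit_mul :
  smash_counit ∘ smash_mul = lunit munit ∘ (smash_counit ⊗₁ smash_counit).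
Proof. diagram. simp_units. solve_isotopy. Qed.

Lemma smash_counit_unit : smash_counit ∘ smash_unit = 1_munit.
Proof. diagram. simp_units. solve_isotopy. Qed.

Lemma smash_comul_mul :
  smash_comul ∘ smash_mul =
  (smash_mul ⊗₁ smash_mul) ∘ mid_swap (X ⊗ B) (X ⊗ B) (X ⊗ B) (X ⊗ B)
  ∘ (smash_comul ⊗₁ smash_comul).
Proof.
  diagram. simp_all. symmetry. simp_all.
  (* With $b$ split into $b_1, ..., b_4$, the sides differ by exchanging $b_2$ and $b_3$: one acts
     on $y_2$, the other multiplies $c_1$. Occurrence 1 of coassociativity groups these two. *)
  rw_at 1 (eq_sym (comul_coassoc B)). rw (act_cocomm T). rw (comul_coassoc B).
  solve_isotopy.
Qed.

Definition smash : Bialgebra C := {|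
  mul_assoc := smash_mul_assoc;
  mul_unitl := smash_mul_unitl;
  mul_unitr := smash_mul_unitr;
  comul_coassoc := smash_comul_coassoc;
  comul_counitl := smash_comul_counitl;
  comul_counitr := smash_comul_counitr;
  comul_mul := smash_comul_mul;
  comul_unit := smash_comul_unit;
  counit_mul := smash_counit_mul;
  counit_unit := smash_counit_unit
|}.

(** * The smash product as a split extension *)

Definition smash_inl : Hom X smash := (1_X ⊗₁ unit B) ∘ iso_inv (runit X).
Definition smash_inr : Hom B smash := (unit X ⊗₁ 1_B) ∘ iso_inv (lunit B).
Definition smash_fst : Hom smash X := runit X ∘ (1_X ⊗₁ counit B).
Definition smash_snd : Hom smash B := lunit B ∘ (counit X ⊗₁ 1_B).

Ltac smash_diagram :=
  unfold preserves_mul, preserves_unit, preserves_comul, preserves_counit,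
    smash_inl, smash_inr, smash_fst, smash_snd;
  cbn [carrier mul unit comul counit smash bialg_mor]; diagram; simp_units; symmetry;
  simp_units; solve_isotopy.

Definition smash_kappa : BialgHom X smash.
Proof. exists smash_inl; smash_diagram. Defined.
Definition smash_sect : BialgHom B smash.
Proof. exists smash_inr; smash_diagram. Defined.
Definition smash_alpha : BialgHom smash B.
Proof. exists smash_snd; smash_diagram. Defined.

(** This recovers the action from the smash product, so the round trip on actions is isomorphic to
    the identity through identity morphisms. *)
Lemma smash_act : smash_fst ∘ mul smash ∘ (smash_inr ⊗₁ smash_inl) = act T.
Proof. smash_diagram. Qed.

Definition split_ext_of_action : SplitExtension C.
Proof.
  refine {| kappa := smash_kappa; alpha := smash_alpha; sect := smash_sect;
            lambda := smash_fst |}; unfold smash_kappa, smash_sect, smash_alpha; cbn [bialg_mor].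
  1-6: smash_diagram.
  (* Here $λ(e b · κ x)$ simplifies to $b ▷ x$, so the condition becomes cocommutativity of the
     action. *)
  - unfold smash_inl, smash_inr, smash_fst, smash_snd.
    cbn [carrier mul unit comul counit smash bialg_mor]. diagram.
    simp_units. rw (act_cocomm T). symmetry. simp_units. solve_isotopy.
  - split; smash_diagram.
  - smash_diagram.
Defined.
End Smash.

(** * The action of a split extension *)

Section Extension.
Variable C : SymmetricMonoidalCategory.
Variable E : SplitExtension C.
Notation X := (se_X E).
Notation A := (se_A E).
Notation B := (se_B E).
Notation κ := (bialg_mor (kappa E)).
Notation α := (bialg_mor (alpha E)).
Notation e := (bialg_mor (sect E)).
Notation λ := (lambda E).

Definition se_act : Hom (B ⊗ X) X := λ ∘ mul A ∘ (e ⊗₁ κ).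
Definition se_factor : Hom (X ⊗ B) A := mul A ∘ (κ ⊗₁ e).

Ltac objects := constr:([carrier X; carrier A; carrier B]).
Ltac generators := constr:((mul X, (unit X, (comul X, (counit X,
  (mul A, (unit A, (comul A, (counit A,
  (mul B, (unit B, (comul B, (counit B, (κ, (α, (e, (λ, (se_act, tt)))))))))))))))))).
Ltac diagram :=
  let os := objects in let gs := generators in reify_goal os gs.
Ltac rw H := let os := objects in let gs := generators in rewrite_diagram os gs 0 H.
Ltac simp_units := repeat first
  [ simp_bialgebra rw constr:(X) | simp_bialgebra rw constr:(A) | simp_bialgebra rw constr:(B)
  | rw (lambda_kappa E) | rw (alpha_sect E) | rw (lambda_sect E) | rw (alpha_kappa E)
  | rw (lambda_unit E)
  | rw (bialg_mor_unit (kappa E)) | rw (bialg_mor_unit (alpha E)) | rw (bialg_mor_unit (sect E))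
  | rw (bialg_mor_counit (kappa E)) | rw (bialg_mor_counit (alpha E))
  | rw (bialg_mor_counit (sect E)) | rw (proj2 (lambda_coalg E)) ].
Ltac push_comul := repeat first
  [ rw (comul_mul A) | rw (bialg_mor_comul (kappa E)) | rw (bialg_mor_comul (sect E))
  | rw (bialg_mor_comul (alpha E)) | rw (proj1 (lambda_coalg E)) ].

(** The commutation rule that moves [e] to the right of [κ]; it drives the multiplicative axioms
    below. *)
Lemma se_swap :
  mul A ∘ (e ⊗₁ κ) =
  mul A ∘ (κ ⊗₁ e) ∘ (se_act ⊗₁ 1_B) ∘ iso_inv (assoc B X B) ∘ (1_B ⊗₁ braid B X)
  ∘ assoc B B X ∘ (comul B ⊗₁ 1_X).
Proof.
  transitivity (mul A ∘ ((κ ∘ λ) ⊗₁ (e ∘ α)) ∘ comul A ∘ (mul A ∘ (e ⊗₁ κ))).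
  { now rewrite se_decomp, comp_idl. }
  (* After comultiplying, [λ] turns the first part into $b_1 ▷ x_1$, and [α] turns the second into
     $b_2 ε(x_2)$ because $α κ$ is trivial. *)
  unfold se_act. diagram. push_comul.
  rw (bialg_mor_mul (alpha E)). simp_units. solve_isotopy.
Qed.

Lemma se_act_unitl : se_act ∘ (unit B ⊗₁ 1_X) = lunit X.
Proof. unfold se_act. diagram. simp_units. solve_isotopy. Qed.

Lemma se_act_unitr : se_act ∘ (1_B ⊗₁ unit X) = unit X ∘ counit B ∘ runit B.
Proof. unfold se_act. diagram. simp_units. solve_isotopy. Qed.

Lemma se_act_cocomm :
  (1_B ⊗₁ se_act) ∘ assoc B B X ∘ (comul B ⊗₁ 1_X) =
  (1_B ⊗₁ se_act) ∘ assoc B B X ∘ (braid B B ⊗₁ 1_X) ∘ (comul B ⊗₁ 1_X).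
Proof. unfold se_act. diagram. rw (se_cocomm E). solve_isotopy. Qed.

Lemma se_act_counit : counit X ∘ se_act = lunit munit ∘ (counit B ⊗₁ counit X).
Proof. unfold se_act. diagram. simp_units. solve_isotopy. Qed.

Lemma se_act_comul :
  comul X ∘ se_act = (se_act ⊗₁ se_act) ∘ mid_swap B B X X ∘ (comul B ⊗₁ comul X).
Proof. unfold se_act. diagram. push_comul. solve_isotopy. Qed.

(** In diagrams [se_act] is an atom; this equation unfolds a single occurrence. *)
Lemma se_actE : se_act = λ ∘ mul A ∘ (e ⊗₁ κ).
Proof. reflexivity. Qed.

(** Two uses of [se_swap] give $e(b) e(c) κ(x) = κ(b_1 ▷ (c_1 ▷ x)) e(b_2 c_2)$, and [lambda_mul]
    discards the last factor. *)
Lemma se_act_mull :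
  se_act ∘ (mul B ⊗₁ 1_X) = se_act ∘ (1_B ⊗₁ se_act) ∘ assoc B B X.
Proof.
  diagram. rw se_actE. rw (bialg_mor_mul (sect E)). rw (mul_assoc A). rw se_swap.
  rw (eq_sym (mul_assoc A)). rw se_swap. rw (mul_assoc A).
  rw (eq_sym (bialg_mor_mul (sect E))). rw (lambda_mul E). simp_units. solve_isotopy.
Qed.

(** Likewise $e(b) κ(x) κ(y) = κ((b_1 ▷ x)(b_2 ▷ y)) e(b_3)$, to which [lambda_mul] applies. *)
Lemma se_act_mulr :
  se_act ∘ (1_B ⊗₁ mul X) =
  mul X ∘ (se_act ⊗₁ se_act) ∘ mid_swap B B X X ∘ (comul B ⊗₁ (1_X ⊗₁ 1_X)).
Proof.
  diagram. rw se_actE. rw (bialg_mor_mul (kappa E)). rw (eq_sym (mul_assoc A)). rw se_swap.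
  rw (mul_assoc A). rw se_swap. rw (eq_sym (mul_assoc A)).
  rw (eq_sym (bialg_mor_mul (kappa E))). rw (lambda_mul E). simp_units. solve_isotopy.
Qed.

Definition action_of_split_ext : Action C := {|
  act_unitl := se_act_unitl;
  act_unitr := se_act_unitr;
  act_cocomm := se_act_cocomm;
  act_counit := se_act_counit;
  act_comul := se_act_comul;
  act_mull := se_act_mull;
  act_mulr := se_act_mulr
|}.

(** * Comparison of the smash product with the middle bialgebra *)

Lemma se_factor_mul :
  se_factor ∘ smash_mul action_of_split_ext = mul A ∘ (se_factor ⊗₁ se_factor).
Proof.
  unfold smash_mul, smash_swap, se_factor. cbn [action_of_split_ext act act_B act_X].
  diagram. rw (bialg_mor_mul (kappa E)). rw (bialg_mor_mul (sect E)).
  rw (mul_assoc A). symmetry. rw (mul_assoc A). rw (eq_sym (mul_assoc A)).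
  (* In $κ(x) e(b) κ(y) e(c)$ the middle product $e(b) κ(y)$ is now exposed. *)
  rw se_swap. rw (mul_assoc A). solve_isotopy.
Qed.

Lemma se_factor_unit : se_factor ∘ smash_unit action_of_split_ext = unit A.
Proof.
  unfold smash_unit, se_factor. cbn [action_of_split_ext act act_B act_X].
  diagram. simp_units. solve_isotopy.
Qed.

Lemma se_factor_comul :
  comul A ∘ se_factor = (se_factor ⊗₁ se_factor) ∘ smash_comul action_of_split_ext.
Proof.
  unfold smash_comul, se_factor. cbn [action_of_split_ext act act_B act_X].
  diagram. push_comul. solve_isotopy.
Qed.

Lemma se_factor_counit :
  counit A ∘ se_factor = smash_counit action_of_split_ext.
Proof.
  unfold smash_counit, se_factor. cbn [action_of_split_ext act act_B act_X].
  diagram. simp_units. solve_isotopy.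
Qed.

(** Comultiplying $κ(x) e(b)$ gives two such products; [lambda_mul] keeps $x_1$ from the first, [α]
    keeps $b_2$ from the second, and counits remove the rest. *)
Lemma se_factor_retract : (λ ⊗₁ α) ∘ comul A ∘ se_factor = 1_(X ⊗ B).
Proof.
  unfold se_factor. diagram. push_comul. rw (bialg_mor_mul (alpha E)). rw (lambda_mul E).
  simp_units. solve_isotopy.
Qed.

Lemma se_factor_section : se_factor ∘ ((λ ⊗₁ α) ∘ comul A) = 1_A.
Proof. unfold se_factor. rewrite <- (se_decomp E), tensm_comp. now rewrite !comp_assoc. Qed.

Lemma se_factor_inl : se_factor ∘ smash_inl action_of_split_ext = κ.
Proof.
  unfold smash_inl, se_factor. cbn [action_of_split_ext act act_B act_X carrier smash].
  diagram. simp_units. solve_isotopy.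
Qed.

Lemma se_factor_inr : se_factor ∘ smash_inr action_of_split_ext = e.
Proof.
  unfold smash_inr, se_factor. cbn [action_of_split_ext act act_B act_X carrier smash].
  diagram. simp_units. solve_isotopy.
Qed.

Lemma se_factor_alpha : α ∘ se_factor = smash_snd action_of_split_ext.
Proof.
  unfold smash_snd, se_factor. cbn [action_of_split_ext act act_B act_X carrier smash].
  diagram. rw (bialg_mor_mul (alpha E)). simp_units. solve_isotopy.
Qed.

Lemma se_factor_lambda : λ ∘ se_factor = smash_fst action_of_split_ext.
Proof.
  unfold smash_fst, se_factor. cbn [action_of_split_ext act act_B act_X carrier smash].
  rewrite <- lambda_mul. apply eq_sym, comp_assoc.
Qed.
End Extension.

(** * The equivalence *)

Lemma preserves_inverse (C : SymmetricMonoidalCategory) (A B : Bialgebra C)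
  (f : BialgHom A B) (g : Hom B A) : g ∘ f = 1_A -> f ∘ g = 1_B ->
  preserves_mul g /\ preserves_unit g /\ preserves_comul g /\ preserves_counit g.
Proof.
  intros gf fg. unfold preserves_mul, preserves_unit, preserves_comul, preserves_counit.
  assert (ff : (f ⊗₁ f) ∘ (g ⊗₁ g) = 1_(B ⊗ B)) by now rewrite <- tensm_comp, fg, tensm_id.
  assert (gg : (g ⊗₁ g) ∘ (f ⊗₁ f) = 1_(A ⊗ A)) by now rewrite <- tensm_comp, gf, tensm_id.
  repeat split.
  - rewrite <- (comp_idr (mul B)), <- ff, <- (comp_assoc (mul B)), <- bialg_mor_mul.
    now rewrite <- !comp_assoc, gf, comp_idl.
  - now rewrite <- (bialg_mor_unit f), <- comp_assoc, gf, comp_idl.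
  - rewrite <- (comp_idl (comul A)), <- gg, (comp_assoc (g ⊗₁ g)), <- bialg_mor_comul.
    now rewrite !comp_assoc, fg, comp_idr.
  - now rewrite <- (bialg_mor_counit f), comp_assoc, fg, comp_idr.
Qed.

Section Functors.
Variable C : SymmetricMonoidalCategory.

Section ActionMorphism.
Variables (T T' : Action C) (f : ActionHom T T').
Notation X := (act_X T).
Notation B := (act_B T).
Notation X' := (act_X T').
Notation B' := (act_B T').
Notation g := (bialg_mor (acth_g f)).
Notation v := (bialg_mor (acth_v f)).

Ltac objects := constr:([carrier X; carrier B; carrier X'; carrier B']).
Ltac generators := constr:((mul X, (unit X, (comul X, (counit X,
  (mul B, (unit B, (comul B, (counit B, (act T,
  (mul X', (unit X', (comul X', (counit X',
  (mul B', (unit B', (comul B', (counit B', (act T', (g, (v, tt))))))))))))))))))))).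
Ltac rw H := let os := objects in let gs := generators in rewrite_diagram os gs 0 H.
(** Morphisms move towards the inputs, so preservation of comultiplication is used from right to
    left. *)
Ltac simp_hom := repeat first
  [ rw (bialg_mor_mul (acth_g f)) | rw (bialg_mor_mul (acth_v f))
  | rw (bialg_mor_unit (acth_g f)) | rw (bialg_mor_unit (acth_v f))
  | rw (eq_sym (bialg_mor_comul (acth_g f))) | rw (eq_sym (bialg_mor_comul (acth_v f)))
  | rw (bialg_mor_counit (acth_g f)) | rw (bialg_mor_counit (acth_v f))
  | rw (acth_act f) ].
Ltac solve_hom :=
  unfold preserves_mul, preserves_unit, preserves_comul, preserves_counit,
    smash_inl, smash_inr, smash_fst, smash_snd;
  cbn [carrier mul unit comul counit smash bialg_mor];
  unfold smash_mul, smash_unit, smash_comul, smash_counit, smash_swap;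
  let os := objects in let gs := generators in reify_goal os gs;
  simp_hom; symmetry; simp_hom; solve_isotopy.

Definition smash_hom : BialgHom (smash T) (smash T').
Proof. exists (v ⊗₁ g); solve_hom. Defined.

Definition split_ext_of_action_hom :
  SplitExtHom (split_ext_of_action T) (split_ext_of_action T').
Proof.
  exists (acth_g f) (acth_v f) smash_hom;
    cbn [split_ext_of_action kappa alpha sect lambda smash_kappa smash_alpha smash_sect smash_hom
      bialg_mor se_A se_B se_X]; solve_hom.
Defined.
End ActionMorphism.

Definition functor_of_actions : Functor (Act C) (SplitExt C).
Proof.
  refine {| fob := fun T : Act C => split_ext_of_action T : SplitExt C;
            fmap := fun T T' f => split_ext_of_action_hom f |}; simpl.
  - intros T. apply SplitExtHom_eq; try reflexivity. apply BialgHom_eq, tensm_id.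
  - intros T T' T'' f' f. apply SplitExtHom_eq; try reflexivity.
    apply BialgHom_eq, tensm_comp.
Defined.

Definition action_of_split_ext_hom (E E' : SplitExtension C) (f : SplitExtHom E E') :
  ActionHom (action_of_split_ext E) (action_of_split_ext E').
Proof.
  exists (seh_g f) (seh_v f). simpl. unfold se_act.
  rewrite <- !comp_assoc, <- seh_lambda, (comp_assoc (lambda E')), bialg_mor_mul.
  rewrite !comp_assoc, <- !tensm_comp. now rewrite seh_sect, seh_kappa.
Defined.

Definition functor_of_split_exts : Functor (SplitExt C) (Act C).
Proof.
  refine {| fob := fun E : SplitExt C => action_of_split_ext E : Act C;
            fmap := fun E E' f => action_of_split_ext_hom f |}; simpl.
  - intros E. now apply ActionHom_eq.
  - intros E E' E'' f' f. now apply ActionHom_eq.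
Defined.

(** * The natural isomorphisms *)

Definition factor_hom (E : SplitExtension C) : BialgHom (smash (action_of_split_ext E)) (se_A E).
Proof.
  exists (se_factor E : Hom (smash (action_of_split_ext E)) (se_A E)).
  - apply se_factor_mul.
  - apply se_factor_unit.
  - apply se_factor_comul.
  - apply se_factor_counit.
Defined.

Definition cofactor (E : SplitExtension C) : Hom (se_A E) (smash (action_of_split_ext E)) :=
  (lambda E ⊗₁ alpha E) ∘ comul (se_A E).

Definition cofactor_hom (E : SplitExtension C) :
  BialgHom (se_A E) (smash (action_of_split_ext E)).
Proof.
  pose proof (preserves_inverse (f := factor_hom E) (g := cofactor E)
    (se_factor_retract E) (se_factor_section E)) as P.
  exists (cofactor E); apply P.
Defined.

Definition split_ext_factor (E : SplitExtension C) :
  SplitExtHom (split_ext_of_action (action_of_split_ext E)) E.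
Proof.
  refine (@Build_SplitExtHom C (split_ext_of_action (action_of_split_ext E)) E
    (bialg_id (se_B E)) (bialg_id (se_X E)) (factor_hom E) _ _ _ _); simpl;
    rewrite ?comp_idl, ?comp_idr.
  - apply se_factor_inl.
  - apply se_factor_inr.
  - apply se_factor_alpha.
  - apply se_factor_lambda.
Defined.

Definition split_ext_cofactor (E : SplitExtension C) :
  SplitExtHom E (split_ext_of_action (action_of_split_ext E)).
Proof.
  refine (@Build_SplitExtHom C E (split_ext_of_action (action_of_split_ext E))
    (bialg_id (se_B E)) (bialg_id (se_X E)) (cofactor_hom E) _ _ _ _); simpl;
    rewrite ?comp_idl, ?comp_idr; unfold cofactor.
  - rewrite <- se_factor_inl, <- comp_assoc, se_factor_retract. apply comp_idl.
  - rewrite <- se_factor_inr, <- comp_assoc, se_factor_retract. apply comp_idl.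
  - rewrite <- se_factor_alpha, comp_assoc, se_factor_section. apply comp_idr.
  - rewrite <- se_factor_lambda, comp_assoc, se_factor_section. apply comp_idr.
Defined.

Definition split_ext_iso (E : SplitExtension C) :
  @Iso (SplitExt C) (split_ext_of_action (action_of_split_ext E)) E.
Proof.
  refine (@Build_Iso (SplitExt C) _ E (split_ext_factor E) (split_ext_cofactor E) _ _);
    apply SplitExtHom_eq; apply BialgHom_eq; simpl; try apply comp_idl.
  - apply se_factor_retract.
  - apply se_factor_section.
Defined.

Definition action_unfold (T : Action C) :
  ActionHom (action_of_split_ext (split_ext_of_action T)) T.
Proof.
  refine (@Build_ActionHom C (action_of_split_ext (split_ext_of_action T)) T
    (bialg_id (act_B T)) (bialg_id (act_X T)) _). simpl.
  rewrite comp_idl, tensm_id, comp_idr. apply smash_act.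
Defined.

Definition action_fold (T : Action C) :
  ActionHom T (action_of_split_ext (split_ext_of_action T)).
Proof.
  refine (@Build_ActionHom C T (action_of_split_ext (split_ext_of_action T))
    (bialg_id (act_B T)) (bialg_id (act_X T)) _). simpl.
  rewrite comp_idl, tensm_id, comp_idr. symmetry. apply smash_act.
Defined.

Definition action_iso (T : Action C) :
  @Iso (Act C) (action_of_split_ext (split_ext_of_action T)) T.
Proof.
  refine (@Build_Iso (Act C) _ T (action_unfold T) (action_fold T) _ _);
    apply ActionHom_eq; apply BialgHom_eq; simpl; apply comp_idl.
Defined.
End Functors.

Theorem corollary3p5 (C : SymmetricMonoidalCategory) :
  equivalent_categories (SplitExt C) (Act C).
Proof.
  exists (functor_of_split_exts C), (functor_of_actions C). split; constructor.
  - unshelve eexists; [exact (@split_ext_iso C)|].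
    intros E E' f. apply SplitExtHom_eq; apply BialgHom_eq; simpl;
      rewrite ?comp_idl, ?comp_idr; trivial.
    (* Only the component on the middle bialgebra remains: $p(κ(x) e(b)) = κ'(v(x)) e'(g(b))$. *)
    unfold se_factor. rewrite comp_assoc, <- tensm_comp, <- seh_kappa, <- seh_sect.
    now rewrite <- (comp_assoc (seh_p f)), bialg_mor_mul, comp_assoc, <- tensm_comp.
  - unshelve eexists; [exact (@action_iso C)|].
    intros T T' f. apply ActionHom_eq; apply BialgHom_eq; simpl;
      now rewrite comp_idl, comp_idr.
Qed.
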